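(* Let $N\ge 3$. For any $0\le s\le 2$ and $\alpha>1/2$ there exist constants $C=C(\alpha,s)>0$ and $C'=C'(\alpha,s)>0$ such that for every $u\in C_0^\infty(\mathbb{R}^N)$, $$\int_{\mathbb{R}^N_{\pm}}|x_N|^{2\alpha}|\nabla u|^2\,dx\ \ge\ C'\left(\int_{\mathbb{R}^N_{\pm}}|x_N|^{\alpha\cdot 2^*(s)-s}|u|^{2^*(s)}\,dx\right)^{2/2^*(s)}$$ (for each of the two choices of sign), and $$\int_{\mathbb{R}^N}|x_N|^{2\alpha}|\nabla u|^2\,dx\ \ge\ C\left(\int_{\mathbb{R}^N}|x_N|^{\alpha\cdot 2^*(s)-s}|u|^{2^*(s)}\,dx\right)^{2/2^*(s)}.$$
   Context: $x=(x_1,\dots,x_N)\in\mathbb{R}^N$; $\mathbb{R}^N_+=\{x\in\mathbb{R}^N: x_N>0\}$, $\mathbb{R}^N_-=\{x\in\mathbb{R}^N: x_N<0\}$; $2^*(s)=2(N-s)/(N-2)$. $C_0^\infty(\mathbb{R}^N)$ is the space of smooth compactly supported functions on $\mathbb{R}^N$ (not required to vanish on $\{x_N=0\}$). *)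

(* Defs.v *)
From HB Require Import structures.
From mathcomp Require Import all_boot all_order all_algebra.
From mathcomp Require Import all_classical all_reals all_analysis.

Set Implicit Arguments.
Unset Strict Implicit.
Unset Printing Implicit Defensive.

Import Order.TTheory GRing.Theory Num.Theory.
Import numFieldNormedType.Exports.

Local Open Scope classical_set_scope.
Local Open Scope ring_scope.

Definition rV_display : measure_display.
Proof. exact: default_measure_display. Qed.

(* The sigma-algebra on R^n is the one generated by the n coordinates (as the
   library does for n.-tuple T), which is the Borel sigma-algebra. *)
Section measurable_rV.
Context {R : realType} (n : nat).

Let coors : 'I_n -> 'rV[R]_n -> measurableTypeR R := fun i x => x ord0 i.

Let rV_set0 : g_sigma_preimage coors set0.
Proof. exact: sigma_algebra0. Qed.

Let rV_setC A : g_sigma_preimage coors A -> g_sigma_preimage coors (~` A).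
Proof. exact: sigma_algebraC. Qed.

Let rV_bigcup (F : (set 'rV[R]_n)^nat) :
  (forall i, g_sigma_preimage coors (F i)) ->
  g_sigma_preimage coors (\bigcup_i (F i)).
Proof. exact: sigma_algebra_bigcup. Qed.

HB.instance Definition _ := @isMeasurable.Build rV_display
  'rV[R]_n (g_sigma_preimage coors) rV_set0 rV_setC rV_bigcup.

Lemma measurable_coord (i : 'I_n) :
  measurable_fun [set: 'rV[R]_n]
    (fun x => x ord0 i : measurableTypeR R).
Proof.
move=> _ Y mY; rewrite setTI; apply: sub_sigma_algebra => /=.
rewrite -bigcup_seq/=; exists i => /=; first by rewrite mem_index_enum.
by exists Y => //; rewrite setTI.
Qed.

Lemma measurable_fun_rV d (T : measurableType d) (f : T -> 'rV[R]_n) :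
  (forall i, measurable_fun setT
     (fun t => f t ord0 i : measurableTypeR R)) ->
  measurable_fun setT f.
Proof.
move=> mf _ Y mY.
have : measurable `<=` [set A | measurable (f @^-1` A)].
  apply: smallest_sub.
    split => /=.
    - by rewrite preimage_set0.
    - by move=> A mA; rewrite setTD preimage_setC; exact: measurableC.
    - by move=> F mF; rewrite preimage_bigcup; exact: bigcup_measurable.
  rewrite -bigcup_seq => A [i _ [B mB <-]] /=; rewrite setTI.
  by have := mf i measurableT B mB; rewrite setTI.
by move=> /(_ _ mY); rewrite /= setTI.
Qed.

End measurable_rV.

Definition rV_cons {R : realType} (n : nat)
  (p : measurableTypeR R * 'rV[R]_n) : 'rV[R]_n.+1 :=
  row_mx (p.1 : R)%:M p.2 : 'rV[R]_(1 + n).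

Section lebesgue_rV.
Context {R : realType}.
Local Open Scope ereal_scope.

Lemma rV_cons0 n (p : measurableTypeR R * 'rV[R]_n) :
  rV_cons p ord0 ord0 = p.1.
Proof.
have -> : rV_cons p ord0 ord0 =
    row_mx (p.1 : R)%:M p.2 ord0 (lshift n (ord0 : 'I_1)).
  by congr (rV_cons p _ _); exact: val_inj.
by rewrite row_mxEl mxE eqxx mulr1n.
Qed.

Lemma rV_consS n (p : measurableTypeR R * 'rV[R]_n) (i : 'I_n) :
  rV_cons p ord0 (lift ord0 i) = p.2 ord0 i.
Proof.
have -> : rV_cons p ord0 (lift ord0 i) =
    row_mx (p.1 : R)%:M p.2 ord0 (rshift 1 i).
  by congr (rV_cons p _ _); exact: val_inj.
by rewrite row_mxEr.
Qed.

Lemma measurable_rV_cons n :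
  measurable_fun [set: measurableTypeR R * 'rV[R]_n] (@rV_cons R n).
Proof.
apply: measurable_fun_rV => i.
case: (unliftP ord0 i) => [j ->|->].
  under eq_fun do rewrite rV_consS.
  exact: (measurableT_comp (measurable_coord j)).
under eq_fun do rewrite rV_cons0.
exact: measurable_fst.
Qed.

Definition lebesgue_cons n
    (mu : {sigma_finite_measure set 'rV[R]_n -> \bar R}) :
    set 'rV[R]_n.+1 -> \bar R :=
  pushforward (@lebesgue_measure R \x mu) (@rV_cons R n).

Section lebesgue_cons.
Variables (n : nat) (mu : {sigma_finite_measure set 'rV[R]_n -> \bar R}).

Let lebesgue_cons0 : lebesgue_cons mu set0 = 0.
Proof. by rewrite /lebesgue_cons /pushforward preimage_set0 measure0. Qed.

Let lebesgue_cons_ge0 A : 0 <= lebesgue_cons mu A.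
Proof. exact: (measure_ge0 (lebesgue_measure \x mu)). Qed.

Let lebesgue_cons_sigma_additive : semi_sigma_additive (lebesgue_cons mu).
Proof.
have mcons A : measurable A -> measurable (@rV_cons R n @^-1` A).
  by move=> mA; rewrite -[X in measurable X]setTI; exact: measurable_rV_cons.
move=> F mF tF mUF; rewrite /lebesgue_cons /pushforward preimage_bigcup.
apply: measure_semi_sigma_additive.
- by move=> k; exact: mcons.
- apply/trivIsetP => /= i j _ _ ij; rewrite -preimage_setI.
  by move/trivIsetP : tF => /(_ _ _ _ _ ij) ->//; rewrite preimage_set0.
- by rewrite -preimage_bigcup; exact: mcons.
Qed.

HB.instance Definition _ := isMeasure.Build _ _ _ (lebesgue_cons mu)
  lebesgue_cons0 lebesgue_cons_ge0 lebesgue_cons_sigma_additive.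

Let lebesgue_cons_sigma_finite : sigma_finite setT (lebesgue_cons mu).
Proof.
have /sigma_finiteP[F [TF ndF Foo]] := sigma_finiteT (@lebesgue_measure R).
have /sigma_finiteP[G [TG ndG Goo]] := sigma_finiteT mu.
pose un (x : 'rV[R]_n.+1) : measurableTypeR R * 'rV[R]_n :=
  (x ord0 ord0, \row_i x ord0 (lift ord0 i)).
have consK : cancel (@rV_cons R n) un.
  move=> [a v]; rewrite /un rV_cons0; congr pair.
  by apply/rowP => i; rewrite mxE rV_consS.
have mun : measurable_fun setT un.
  apply: measurable_fun_pair; first exact: measurable_coord.
  apply: measurable_fun_rV => i; under eq_fun do rewrite mxE.
  exact: measurable_coord.
exists (fun k => un @^-1` (F k `*` G k)).
  rewrite -preimage_bigcup; apply/esym/seteqP; split => // x _.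
  have : [set: measurableTypeR R] (un x).1 by [].
  rewrite TF => -[k _ Fk].
  have : [set: 'rV[R]_n] (un x).2 by [].
  rewrite TG => -[l _ Gl].
  exists (maxn k l) => //; split.
    by move: Fk; exact/subsetPset/ndF/leq_maxl.
  by move: Gl; exact/subsetPset/ndG/leq_maxr.
move=> k; have [mF Fk] := Foo k; have [mG Gk] := Goo k.
have mFG : measurable (F k `*` G k) by exact: measurableX.
split; first by rewrite -[X in measurable X]setTI; exact: mun.
rewrite /lebesgue_cons /pushforward -comp_preimage.
rewrite (_ : un \o _ = id) ?preimage_id; last by apply/funext => p; exact: consK.
by rewrite product_measure1E// lte_mul_pinfty// ge0_fin_numE.
Qed.

HB.instance Definition _ := Measure_isSigmaFinite.Build _ _ _
  (lebesgue_cons mu) lebesgue_cons_sigma_finite.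

End lebesgue_cons.

(* Lebesgue measure on R^n: the unit mass on the point R^0, then the image of
   lebesgue_measure \x lebesgue_rV n under (a, v) |-> (a, v_1, ..., v_n). *)
Fixpoint lebesgue_rV (n : nat) :
    {sigma_finite_measure set 'rV[R]_n -> \bar R} :=
  match n with
  | 0 => dirac (0%R : 'rV[R]_0)
  | n'.+1 => lebesgue_cons (lebesgue_rV n')
  end.

Lemma lebesgue_rV_box n (A : 'I_n -> set (measurableTypeR R)) :
  (forall i, measurable (A i)) ->
  lebesgue_rV n [set x : 'rV[R]_n | forall i, A i (x ord0 i)] =
  \prod_(i < n) lebesgue_measure (A i).
Proof.
elim: n A => [|n ih] A mA.
  rewrite big_ord0 /= diracE mem_set//= => -[].
  by [].
rewrite big_ord_recl -ih//= /lebesgue_cons /pushforward.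
rewrite -product_measure1E//; last first.
  have -> : [set x : 'rV[R]_n | forall i, A (lift ord0 i) (x ord0 i)] =
     \bigcap_(i in [set: 'I_n])
       ((fun x : 'rV[R]_n => x ord0 i : measurableTypeR R) @^-1`
         A (lift ord0 i)).
    by apply/seteqP; split => x /= h i; [move=> _|]; exact: h.
  apply: fin_bigcap_measurable => // i _.
  by rewrite -[X in measurable X]setTI; exact: measurable_coord.
congr (_ _); apply/seteqP; split => -[a v] /=.
  move=> h; split; first by have := h ord0; rewrite rV_cons0.
  by move=> i; have := h (lift ord0 i); rewrite rV_consS.
move=> -[Aa Av] i; case: (unliftP ord0 i) => [j ->|->].
  by rewrite rV_consS; exact: Av.
by rewrite rV_cons0.
Qed.

End lebesgue_rV.

Section calculus.
Context {R : realType} {n : nat}.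
Implicit Type u : 'rV[R]_n -> R.

Definition basis_vec (i : 'I_n) : 'rV[R]_n := delta_mx ord0 i.

Definition partial (i : 'I_n) u : 'rV[R]_n -> R :=
  fun x => 'D_(basis_vec i) u x.

Definition partials (l : seq 'I_n) u : 'rV[R]_n -> R := foldr partial u l.

Definition smooth u : Prop :=
  forall l : seq 'I_n, continuous (partials l u) /\
    forall (i : 'I_n) x, derivable (partials l u) x (basis_vec i).

Definition compact_support u : Prop :=
  compact (closure [set x | u x != 0]).

Definition Cc_infty u : Prop := smooth u /\ compact_support u.

Definition gradient u (x : 'rV[R]_n) : 'rV[R]_n := \row_i partial i u x.

(* Euclidean norm: `|v| is the sup norm on 'rV[R]_n. *)
Definition enorm (v : 'rV[R]_n) : R := Num.sqrt (\sum_i v ord0 i ^+ 2).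

End calculus.

Definition last_coord {R : realType} {n : nat} (x : 'rV[R]_n.+1) : R :=
  x ord0 ord_max.

Definition upper_half {R : realType} {n : nat} : set 'rV[R]_n.+1 :=
  [set x | 0 < last_coord x].

Definition lower_half {R : realType} {n : nat} : set 'rV[R]_n.+1 :=
  [set x | last_coord x < 0].

Definition crit_exp {R : realType} (N : nat) (s : R) : R :=
  2 * (N%:R - s) / (N%:R - 2).

Definition grad_energy {R : realType} {n : nat} (D : set 'rV[R]_n.+1)
    (alpha : R) (u : 'rV[R]_n.+1 -> R) : \bar R :=
  (\int[lebesgue_rV n.+1]_(x in D)
    (`|last_coord x| `^ (2 * alpha) * enorm (gradient u x) ^+ 2)%:E)%E.

(* On the hyperplane x_N = 0 powR gives a negative power of |x_N| the
   value 0; this is a null set. *)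
Definition weighted_Lp_sq {R : realType} {n : nat} (D : set 'rV[R]_n.+1)
    (s alpha : R) (u : 'rV[R]_n.+1 -> R) : \bar R :=
  let p := crit_exp n.+1 s in
  ((\int[lebesgue_rV n.+1]_(x in D)
    (`|last_coord x| `^ (alpha * p - s) * `|u x| `^ p)%:E) `^ (2 / p))%E.

(* Main.v *)
Require Import Defs.
From mathcomp Require Import all_boot all_order all_algebra.
From mathcomp Require Import all_classical all_reals all_analysis.
From mathcomp Require Import measurable_realfun.
From mathcomp Require Import ring lra.

(** Put N = n + 1, 2* = 2 N / (N - 2) and v = |x_N| ^ alpha * |u|. On a
    half-space the integrand of the weighted norm is the product of
    (v / x_N) ^ 2 to the power s / 2 and of v ^ 2* to the power 1 - s / 2, so by
    Hoelder's inequality it is enough to bound, by the weighted energy E, the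
    integrals of these two functions, that is to treat s = 2 and s = 0
    ([half_space_interpolation]).

    For s = 2 this is Hardy's inequality in the variable x_N
    ([hardy_half_space]). On a line, let k = 2 alpha - 1 > 0 and compare
    |t| ^ (k + 1) * u' ^ 2 with |t| ^ (k - 1) * u ^ 2: up to the derivative of
    |t| ^ k * u ^ 2 and constant factors, the difference is a square. The
    boundary term at t = 0 has the right sign, which is why u need not vanish on
    the hyperplane.

    For s = 0 this is a Sobolev inequality for v ([weighted_sobolev]), obtained
    as for smooth functions although v is not smooth. Let
    q = 2 (N - 1) / (N - 2) and
    h = |x_N| ^ alpha * |grad u| + alpha * |x_N| ^ (alpha - 1) * |u|, which
    dominates the gradient of v. Integrating derivatives from infinity, without
    ever crossing the hyperplane, bounds v ^ q at every point by the integral of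
    q * v ^ (q - 1) * h along each coordinate line through it, restricted to the
    half-space ([weighted_line_bounded]). Gagliardo's inequality ([gagliardo])
    then bounds the integral A of v ^ 2* by the power N / (N - 1) of the
    integral of q * v ^ (q - 1) * h, which is at most q times the square roots
    of A and of the integral J of h ^ 2. As A is finite, it can be absorbed
    on the left, and J is at most a constant times E by Hardy's inequality.

    On the whole space, add up the inequalities of the two half-spaces
    ([integral_half_spaces]). *)

Set Implicit Arguments.
Unset Strict Implicit.
Unset Printing Implicit Defensive.

Import Order.TTheory GRing.Theory Num.Theory.
Import numFieldNormedType.Exports.

Local Open Scope classical_set_scope.
Local Open Scope ring_scope.

(** * Measurability and Hoelder's inequality *)

Lemma measurable_fun_powR d (T : measurableType d) (R : realType) (D : set T)
    (f : T -> R) (r : R) :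
  measurable_fun D f -> measurable_fun D (fun x => f x `^ r).
Proof. by move=> mf; exact: (measurableT_comp (measurable_powR _)). Qed.

Lemma measurable_fun_poweR d (T : measurableType d) (R : realType) (D : set T)
    (f : T -> \bar R) (r : R) :
  measurable_fun D f -> measurable_fun D (fun x => f x `^ r)%E.
Proof. by move=> mf; exact: (measurableT_comp (measurable_poweR r)). Qed.

(** The sigma-algebra of the row vectors is generated by the coordinates, not by
    the open sets. Rounding each coordinate down to a multiple of 1 / (k + 1)
    turns [u] into a function constant on countably many measurable cells, and
    by continuity these functions converge to [u] pointwise. *)
Lemma continuous_measurable_rV (R : realType) (n : nat) (u : 'rV[R]_n -> R) :
  continuous u -> measurable_fun [set: 'rV[R]_n] u.
Proof.
move=> cu.
pose phi (k : nat) (x : 'rV[R]_n) : 'rV[R]_n :=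
  \row_i ((Num.floor (k.+1%:R * x ord0 i))%:~R / k.+1%:R).
apply: (@measurable_fun_cvg _ _ _ setT (fun k => u \o phi k)) => [k|x _].
  pose psi (z : {ffun 'I_n -> int}) : 'rV[R]_n := \row_i ((z i)%:~R / k.+1%:R).
  pose cell (z : {ffun 'I_n -> int}) : set 'rV[R]_n :=
    \bigcap_(i in [set: 'I_n])
      ((fun x : 'rV[R]_n => x ord0 i : measurableTypeR R)
        @^-1` [set t | Num.floor (k.+1%:R * t) = z i]).
  have mcell z : measurable (cell z).
    apply: fin_bigcap_measurable => // i _.
    rewrite -[X in measurable X]setTI; apply: measurable_coord => //.
    rewrite (_ : [set t | _] =
      `[((z i)%:~R / k.+1%:R : R), ((z i + 1)%:~R / k.+1%:R)[%classic).
      exact: measurable_itv.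
    apply/seteqP; split => t /=; rewrite in_itv/= ler_pdivrMr ?ltr0n//;
      rewrite ltr_pdivlMr ?ltr0n//.
      by move=> <-; rewrite mulrC floor_le lt_succ_floor.
    by rewrite (mulrC t) => ?; exact: floor_def.
  move=> _ Y mY; rewrite setTI.
  have -> : (u \o phi k) @^-1` Y =
    \bigcup_(z in [set z | Y (u (psi z))]) cell z.
    apply/seteqP; split => x /=.
      move=> Yx; exists [ffun i => Num.floor (k.+1%:R * x ord0 i)] => /=.
        rewrite (_ : psi _ = phi k x)//.
        by apply/rowP => i; rewrite !mxE ffunE.
      by move=> i _ /=; rewrite ffunE.
    move=> [z /= Yz zx]; rewrite (_ : phi k x = psi z)//.
    by apply/rowP => i; rewrite !mxE (zx i).
  rewrite bigcup_mkcond; apply: countable_bigcupT_measurable => // z.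
  by case: ifPn => // _; exact: mcell.
rewrite /=; apply: (cvg_comp _ u _ (cu x)).
apply/cvg_ballP => e e0; near=> k; split => // i j; rewrite !ord1.
rewrite mxE /ball/=.
have k0 : (0 : R) < k.+1%:R by rewrite ltr0n.
have le1 := floor_le (k.+1%:R * x ord0 j).
have le2 := lt_succ_floor (k.+1%:R * x ord0 j).
have ke : k.+1%:R^-1 < e.
  by near: k; exact: near_infty_natSinv_lt (PosNum e0).
apply: le_lt_trans ke; rewrite ger0_norm.
  rewrite lerBlDr -(@ler_pM2l _ k.+1%:R)// mulrDr mulfV ?gt_eqF//.
  rewrite mulrCA mulfV ?gt_eqF// mulr1 addrC.
  by move: le2; rewrite intrD; exact: ltW.
by rewrite subr_ge0 ler_pdivrMr// [leRHS]mulrC.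
Unshelve. all: by end_near. Qed.

(** Weighted arithmetic-geometric mean inequality for x / a and y / b. *)
Lemma young_normalized (R : realType) (x y a b t : R) :
  0 <= x -> 0 <= y -> 0 < a -> 0 < b -> 0 < t -> t < 1 ->
  x `^ t * y `^ (1 - t) <=
    a `^ t * b `^ (1 - t) * (t / a * x + (1 - t) / b * y).
Proof.
move=> x0 y0 a0 b0 t0 t1.
have s0 : 0 < 1 - t by rewrite subr_gt0.
have [X X0 ->] : exists2 X, 0 <= X & x = a * X.
  by exists (x / a); [rewrite divr_ge0// ltW|rewrite mulrC divfK ?gt_eqF].
have [Y Y0 ->] : exists2 Y, 0 <= Y & y = b * Y.
  by exists (y / b); [rewrite divr_ge0// ltW|rewrite mulrC divfK ?gt_eqF].
have := @conjugate_powR _ (X `^ t) (Y `^ (1 - t)) t^-1 (1 - t)^-1.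
rewrite !powR_ge0 !invr_gt0 !invrK => /(_ isT isT t0 s0).
rewrite addrC subrK => /(_ erefl).
rewrite -!powRrM !mulfV ?gt_eqF// !powRr1// => h.
rewrite (powRM _ (ltW a0) X0) (powRM _ (ltW b0) Y0) mulrACA.
rewrite ler_pM2l ?mulr_gt0 ?powR_gt0//.
apply: le_trans h _; rewrite le_eqVlt; apply/orP; left; apply/eqP.
by field; rewrite !gt_eqF.
Qed.

Section hoelder.
Context d (T : measurableType d) {R : realType}.
Variable mu : {measure set T -> \bar R}.
Local Open Scope ereal_scope.

(** Extended-real values are needed because the inequality is applied below to
    an integral over lines, which may be infinite at some points. The endpoints
    t = 0 and t = 1 are included, with the convention that a zeroth power is 1.
    When both integrals are positive and finite, integrate the weighted
    arithmetic-geometric mean inequality normalized by them. *)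
Lemma hoelder_poweR (f g : T -> \bar R) (t : R) : (0 <= t <= 1)%R ->
  measurable_fun setT f -> measurable_fun setT g ->
  (forall x, 0 <= f x) -> (forall x, 0 <= g x) ->
  \int[mu]_x (f x `^ t * g x `^ (1 - t)) <=
  (\int[mu]_x f x) `^ t * (\int[mu]_x g x) `^ (1 - t).
Proof.
move=> /andP[t0 t1] mf mg f0 g0.
have If0 : 0 <= \int[mu]_x f x by exact: integral_ge0.
have Ig0 : 0 <= \int[mu]_x g x by exact: integral_ge0.
move: t0; rewrite le_eqVlt => /predU1P[<-|t0].
  rewrite poweRe0 mul1e subr0 poweRe1//.
  by under eq_integral do rewrite poweRe0 mul1e poweRe1//.
move: t1; rewrite le_eqVlt => /predU1P[->|t1].
  rewrite subrr poweRe0 mule1 poweRe1//.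
  by under eq_integral do rewrite poweRe0 mule1 poweRe1//.
have s0 : (0 < 1 - t)%R by rewrite subr_gt0.
have null h r (k : T -> \bar R) : measurable_fun setT h ->
    (forall x, 0 <= h x) -> (0 < r)%R -> measurable_fun setT k ->
    \int[mu]_x h x = 0 -> \int[mu]_x (h x `^ r * k x) = 0.
  move=> mh h0 r0 mk Ih.
  have : ae_eq mu setT h (cst 0).
    by apply/ae_eq_integral_abs => //; under eq_integral do rewrite gee0_abs//.
  move=> hae; transitivity (\int[mu]_x (cst 0 : T -> \bar R) x).
    apply: ae_eq_integral => //.
      by apply: emeasurable_funM => //; exact: measurable_fun_poweR.
    near=> x => _; have -> : h x = 0 by have : [set: T] x by []; near: x.
    by rewrite poweR0r ?gt_eqF// mul0e.
  by rewrite integral0.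
have [f00|fN0] := eqVneq (\int[mu]_x f x) 0.
  by rewrite null ?mule_ge0 ?poweR_ge0//; exact: measurable_fun_poweR.
have [g00|gN0] := eqVneq (\int[mu]_x g x) 0.
  under eq_integral do rewrite muleC.
  by rewrite null ?mule_ge0 ?poweR_ge0//; exact: measurable_fun_poweR.
have fp : 0 < \int[mu]_x f x by rewrite lt0e fN0.
have gp : 0 < \int[mu]_x g x by rewrite lt0e gN0.
have [fy|fNy] := eqVneq (\int[mu]_x f x) +oo.
  by rewrite fy poweRyr ?gt_eqF// gt0_mulye ?leey// poweR_gt0.
have [gy|gNy] := eqVneq (\int[mu]_x g x) +oo.
  by rewrite gy poweRyr ?gt_eqF// gt0_muley ?leey// poweR_gt0.
have /fineK fE : \int[mu]_x f x \is a fin_num by rewrite ge0_fin_numE// ltey.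
have /fineK gE : \int[mu]_x g x \is a fin_num by rewrite ge0_fin_numE// ltey.
move: fp gp; rewrite -fE -gE !lte_fin.
set a := fine _; set b := fine _ => a0 b0.
rewrite !poweR_EFin -EFinM.
have c0 : (0 < a `^ t * b `^ (1 - t))%R by rewrite mulr_gt0// powR_gt0.
have ta0 : (0 < t / a)%R by rewrite divr_gt0.
have sb0 : (0 < (1 - t) / b)%R by rewrite divr_gt0.
have point x : f x `^ t * g x `^ (1 - t) <=
   (a `^ t * b `^ (1 - t))%:E * ((t / a)%:E * f x + ((1 - t) / b)%:E * g x).
  have := f0 x; have := g0 x.
  case: (f x) (g x) => [p| |] [q| |]//.
  - rewrite !lee_fin => q0 p0; exact: young_normalized.
  - by move=> _ _; rewrite gt0_muley ?lte_fin// addey//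
      gt0_muley ?lte_fin// leey.
  - by move=> _ _; rewrite gt0_muley ?lte_fin// addye//
      gt0_muley ?lte_fin// leey.
  - by move=> _ _; rewrite gt0_muley ?lte_fin// addye
      ?gt0_muley// ?lte_fin// leey.
apply: le_trans.
  apply: ge0_le_integral; last by move=> x _; exact: point.
  - by [].
  - by move=> x _; rewrite mule_ge0 ?poweR_ge0.
  - by apply: emeasurable_funM => //; exact: measurable_fun_poweR.
  - apply: emeasurable_funM => //; apply: emeasurable_funD;
      exact: measurable_funeM.
have m1 : measurable_fun setT (fun x => (t / a)%:E * f x).
  exact: measurable_funeM.
have m2 : measurable_fun setT (fun x => ((1 - t) / b)%:E * g x).
  exact: measurable_funeM.
have p1 x : 0 <= (t / a)%:E * f x by rewrite mule_ge0// lee_fin ltW.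
have p2 x : 0 <= ((1 - t) / b)%:E * g x by rewrite mule_ge0// lee_fin ltW.
rewrite ge0_integralZl//; last 3 first.
- exact: emeasurable_funD.
- by move=> x _; rewrite adde_ge0.
- by rewrite lee_fin ltW.
have tle : (0 <= t / a)%R := ltW ta0.
have sle : (0 <= (1 - t) / b)%R := ltW sb0.
rewrite ge0_integralD// ge0_integralZl// ge0_integralZl//.
by rewrite -fE -gE -/a -/b -!EFinM lee_fin !divfK ?gt_eqF// addrC subrK mulr1.
Unshelve. all: by end_near. Qed.

End hoelder.

Lemma hoelder_poweR_on d (T : measurableType d) (R : realType)
    (mu : {measure set T -> \bar R}) (D : set T) (f g : T -> \bar R) (t : R) :
  measurable D -> 0 <= t <= 1 ->
  measurable_fun D f -> measurable_fun D g ->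
  (forall x, D x -> (0 <= f x)%E) -> (forall x, D x -> (0 <= g x)%E) ->
  (\int[mu]_(x in D) (f x `^ t * g x `^ (1 - t)) <=
  (\int[mu]_(x in D) f x) `^ t * (\int[mu]_(x in D) g x) `^ (1 - t))%E.
Proof.
move=> mD t01 mf mg f0 g0.
have rf0 x : (0 <= (f \_ D) x)%E.
  by rewrite patchE; case: ifPn => // /set_mem/f0.
have rg0 x : (0 <= (g \_ D) x)%E.
  by rewrite patchE; case: ifPn => // /set_mem/g0.
have mrf : measurable_fun setT (f \_ D) by exact/(measurable_restrictT _ mD).
have mrg : measurable_fun setT (g \_ D) by exact/(measurable_restrictT _ mD).
rewrite (integral_mkcond D) (integral_mkcond D f) (integral_mkcond D g).
apply: le_trans (hoelder_poweR _ t01 mrf mrg rf0 rg0).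
apply: ge0_le_integral => //.
- move=> x _; rewrite patchE; case: ifPn => // _.
  by rewrite mule_ge0 ?poweR_ge0.
- apply/(measurable_restrictT _ mD).
  by apply: emeasurable_funM; exact: measurable_fun_poweR.
- by apply: emeasurable_funM; exact: measurable_fun_poweR.
move=> x _; rewrite patchE; case: ifPn => xD.
  by rewrite !patchE xD.
by rewrite mule_ge0 ?poweR_ge0.
Qed.

(** * Slicing along coordinate lines *)

(** As [t] varies, this runs along the line through [x] in the [i]-th
    direction. *)
Definition rV_upd {R : realType} {n : nat} (x : 'rV[R]_n) (i : 'I_n) (t : R) :
  'rV[R]_n := \row_j (if j == i then t else x ord0 j).

Section slicing.
Context {R : realType}.
Local Open Scope ereal_scope.
Local Notation lambda := (@lebesgue_measure R).

Lemma rV_upd_cons0 n (a t : R) (y : 'rV[R]_n) :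
  rV_upd (rV_cons (a, y)) ord0 t = rV_cons (t, y).
Proof.
apply/rowP => i; rewrite mxE; case: (unliftP ord0 i) => [j ->|->].
  by rewrite eq_sym (negbTE (neq_lift _ _)) [LHS]rV_consS [RHS]rV_consS.
by rewrite eqxx [RHS]rV_cons0.
Qed.

Lemma rV_upd_consS n (a t : R) (y : 'rV[R]_n) (k : 'I_n) :
  rV_upd (rV_cons (a, y)) (lift ord0 k) t = rV_cons (a, rV_upd y k t).
Proof.
apply/rowP => i; rewrite mxE; case: (unliftP ord0 i) => [j ->|->].
  rewrite (inj_eq lift_inj) [X in (if _ then _ else X)]rV_consS [RHS]rV_consS.
  by rewrite mxE.
by rewrite (negbTE (neq_lift _ _)) [LHS]rV_cons0 [RHS]rV_cons0.
Qed.

Lemma measurable_rV_consr n (a : R) :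
  measurable_fun [set: 'rV[R]_n] (fun y => rV_cons (a, y)).
Proof.
exact: (measurableT_comp (@measurable_rV_cons R n) (measurable_pair1 a)).
Qed.

Lemma measurable_rV_upd n (x : 'rV[R]_n) (i : 'I_n) :
  measurable_fun [set: measurableTypeR R] (rV_upd x i).
Proof.
apply: measurable_fun_rV => j.
have -> : (fun t : measurableTypeR R =>
    rV_upd x i t ord0 j : measurableTypeR R) =
    if j == i then id else cst (x ord0 j).
  by apply/funext => t; rewrite mxE; case: ifP.
by case: ifP => _; [exact: measurable_id|exact: measurable_cst].
Qed.

Section tonelli.
Variables (n : nat) (f : 'rV[R]_n.+1 -> \bar R).
Hypotheses (mf : measurable_fun setT f) (f0 : forall x, 0 <= f x).

Let mfc : measurable_fun setT (f \o @rV_cons R n).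
Proof. by apply: measurableT_comp => //; exact: measurable_rV_cons. Qed.

Lemma integral_rV_consE :
  \int[lebesgue_rV n.+1]_x f x =
  \int[lambda]_a \int[lebesgue_rV n]_y f (rV_cons (a, y)).
Proof.
transitivity (\int[(lambda \x lebesgue_rV n)]_z (f \o @rV_cons R n) z).
  have := @ge0_integral_pushforward _ _ _ _ R _ (@measurable_rV_cons R n)
    (lambda \x lebesgue_rV n) setT f measurableT mf.
  rewrite preimage_setT; apply => x _; exact: f0.
exact (fubini_tonelli1 (f \o @rV_cons R n) mfc (fun z => f0 (rV_cons z))).
Qed.

Lemma integral_rV_cons_swap :
  \int[lebesgue_rV n.+1]_x f x =
  \int[lebesgue_rV n]_y \int[lambda]_a f (rV_cons (a, y)).
Proof.
rewrite integral_rV_consE.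
exact (fubini_tonelli (f \o @rV_cons R n) mfc (fun z => f0 (rV_cons z))).
Qed.

Lemma measurable_integral_rV_cons1 :
  measurable_fun setT (fun y : 'rV[R]_n => \int[lambda]_a f (rV_cons (a, y))).
Proof.
exact (measurable_fun_fubini_tonelli_G (f \o @rV_cons R n) mfc
  (fun z => f0 (rV_cons z))).
Qed.

Lemma measurable_integral_rV_cons2 : measurable_fun setT
  (fun a : measurableTypeR R => \int[lebesgue_rV n]_y f (rV_cons (a, y))).
Proof.
exact (measurable_fun_fubini_tonelli_F (f \o @rV_cons R n) mfc
  (fun z => f0 (rV_cons z))).
Qed.

End tonelli.

(** By Tonelli's theorem. The measure is built by splitting off the first
    coordinate only, so an induction on the dimension peels off coordinates
    until the chosen direction comes first. *)
Lemma le_integral_lines n (i : 'I_n) (f g : 'rV[R]_n -> \bar R) :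
  measurable_fun setT f -> measurable_fun setT g ->
  (forall x, 0 <= f x) -> (forall x, 0 <= g x) ->
  (forall x, \int[lambda]_t f (rV_upd x i t) <=
             \int[lambda]_t g (rV_upd x i t)) ->
  \int[lebesgue_rV n]_x f x <= \int[lebesgue_rV n]_x g x.
Proof.
elim: n i f g => [[]//|n ih] i f g mf mg f0 g0.
case: (unliftP ord0 i) => [j ->|->] fg.
  rewrite !integral_rV_consE//; apply: ge0_le_integral => //.
  - by move=> a _; exact: integral_ge0.
  - exact: measurable_integral_rV_cons2.
  - exact: measurable_integral_rV_cons2.
  move=> a _; apply: (ih j) => // [||y].
  - by apply: measurableT_comp => //; exact: measurable_rV_consr.
  - by apply: measurableT_comp => //; exact: measurable_rV_consr.
  have := fg (rV_cons (a, y)).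
  under eq_integral do rewrite rV_upd_consS.
  by under [leRHS]eq_integral do rewrite rV_upd_consS.
rewrite !integral_rV_cons_swap//; apply: ge0_le_integral => //.
- by move=> a _; exact: integral_ge0.
- exact: measurable_integral_rV_cons1.
- exact: measurable_integral_rV_cons1.
move=> y _; have := fg (rV_cons (0%R, y)).
under eq_integral do rewrite rV_upd_cons0.
by under [leRHS]eq_integral do rewrite rV_upd_cons0.
Qed.

End slicing.

(** * Gagliardo's inequality *)

Section gagliardo.
Context {R : realType}.
Local Open Scope ereal_scope.
Local Notation lambda := (@lebesgue_measure R).

Definition line_bounded n (w g : 'rV[R]_n -> \bar R) :=
  forall (i : 'I_n) x, w x <= \int[lambda]_t g (rV_upd x i t).

(** Paired with an arbitrary [F], Gagliardo's inequality also makes sense on the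
    line, where it is immediate, and so it can be proved by induction from
    there. *)
Let gagliardo_dual_def n := forall F w g : 'rV[R]_n.+1 -> \bar R,
  measurable_fun setT F -> measurable_fun setT w -> measurable_fun setT g ->
  (forall x, 0 <= F x) -> (forall x, 0 <= w x) -> (forall x, 0 <= g x) ->
  line_bounded w g ->
  \int[lebesgue_rV n.+1]_x (F x `^ (n.+1%:R^-1) * w x) <=
  (\int[lebesgue_rV n.+1]_x F x) `^ (n.+1%:R^-1) * \int[lebesgue_rV n.+1]_x g x.

(** Write w ^ ((n + 2) / (n + 1)) as w ^ (1 / (n + 1)) times w. On the slice of
    first coordinate [a], the first [w] is at most the integral [G] of [g] along
    the first direction, which does not depend on [a]; the dual inequality in
    the slice with F = G then gives a constant times the integral of [g] over
    the slice, and it remains to integrate over [a]. *)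
Let gagliardo_primal n : gagliardo_dual_def n ->
  forall w g : 'rV[R]_n.+2 -> \bar R,
  measurable_fun setT w -> measurable_fun setT g ->
  (forall x, 0 <= w x) -> (forall x, 0 <= g x) ->
  line_bounded w g ->
  \int[lebesgue_rV n.+2]_x (w x `^ (n.+2%:R / n.+1%:R)) <=
  (\int[lebesgue_rV n.+2]_x g x) `^ (n.+2%:R / n.+1%:R).
Proof.
move=> dual w g mw mg w0 g0 wg.
have rE : (n.+2%:R / n.+1%:R = n.+1%:R^-1 + 1 :> R)%R.
  by rewrite -[n.+2]add1n natrD mulrDl mul1r divff.
have r0 : (0 <= n.+1%:R^-1 :> R)%R by [].
have powS y : 0 <= y -> y `^ (n.+2%:R / n.+1%:R : R) = y `^ (n.+1%:R^-1) * y.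
  move=> y0; rewrite rE poweRD ?poweRe1//; apply: add_neq0_poweRD_def.
  by rewrite gt_eqF// ltr_wpDl.
pose G y := \int[lambda]_t g (rV_cons (t, y)).
have G0 y : 0 <= G y by exact: integral_ge0.
have mG : measurable_fun setT G by exact: measurable_integral_rV_cons1.
have IG : \int[lebesgue_rV n.+1]_y G y = \int[lebesgue_rV n.+2]_x g x.
  by rewrite [RHS]integral_rV_cons_swap.
have Ig0 : 0 <= \int[lebesgue_rV n.+2]_x g x by exact: integral_ge0.
rewrite integral_rV_consE//; last 2 first.
- exact: measurable_fun_poweR.
- by move=> x; exact: poweR_ge0.
rewrite powS//.
have slice (a : R) :
    \int[lebesgue_rV n.+1]_y w (rV_cons (a, y)) `^ (n.+2%:R / n.+1%:R) <=
    (\int[lebesgue_rV n.+2]_x g x) `^ (n.+1%:R^-1) *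
      \int[lebesgue_rV n.+1]_y g (rV_cons (a, y)).
  have mwa : measurable_fun setT (fun y : 'rV[R]_n.+1 => w (rV_cons (a, y))).
    by apply: measurableT_comp => //; exact: measurable_rV_consr.
  have mga : measurable_fun setT (fun y : 'rV[R]_n.+1 => g (rV_cons (a, y))).
    by apply: measurableT_comp => //; exact: measurable_rV_consr.
  rewrite -IG.
  apply: le_trans (dual G _ _ mG mwa mga _ _ _ _) => //; last first.
    move=> i y; have := wg (lift ord0 i) (rV_cons (a, y)).
    by under eq_integral do rewrite rV_upd_consS.
  apply: ge0_le_integral => //.
  - by move=> y _; exact: poweR_ge0.
  - exact: measurable_fun_poweR.
  - by apply: emeasurable_funM => //; exact: measurable_fun_poweR.
  move=> y _; rewrite powS// lee_wpmul2r//.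
  rewrite gt0_ler_poweR ?in_itv/= ?w0 ?G0 ?leey//.
  have := wg ord0 (rV_cons (a, y)).
  by under eq_integral do rewrite rV_upd_cons0.
apply: (@le_trans _ _ (\int[lambda]_a
    ((\int[lebesgue_rV n.+2]_x g x) `^ (n.+1%:R^-1) *
      \int[lebesgue_rV n.+1]_y g (rV_cons (a, y))))).
  apply: ge0_le_integral => //.
  - by move=> a _; apply: integral_ge0 => y _; exact: poweR_ge0.
  - apply: (@measurable_integral_rV_cons2 _ _ (fun x => w x `^ _)).
      exact: measurable_fun_poweR.
    by move=> x; exact: poweR_ge0.
  - by apply: measurable_funeM; exact: measurable_integral_rV_cons2.
rewrite ge0_integralZl//; last 3 first.
- exact: measurable_integral_rV_cons2.
- by move=> a _; exact: integral_ge0.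
- exact: poweR_ge0.
by rewrite -integral_rV_consE.
Qed.

(** In dimension n + 2 the dual inequality follows from the primal one by
    Hoelder's inequality, and the primal one from the dual one in dimension
    n + 1. *)
Let gagliardo_dual n : gagliardo_dual_def n.
Proof.
elim: n => [|n ih] F w g mF mw mg F0 w0 g0 wg.
  have Ig : forall x, w x <= \int[lebesgue_rV 1]_x g x.
    move=> x; rewrite integral_rV_cons_swap//.
    rewrite [leRHS]integral_dirac ?diracT// ?mul1e; last first.
      exact: measurable_integral_rV_cons1.
    apply: le_trans (wg ord0 x) _; rewrite le_eqVlt; apply/orP; left; apply/eqP.
    apply: eq_integral => t _; congr g; apply/rowP => i.
    by rewrite (ord1 i) mxE eqxx [RHS]rV_cons0.
  have Ig0 : 0 <= \int[lebesgue_rV 1]_x g x by exact: integral_ge0.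
  rewrite invr1 poweRe1 ?integral_ge0// -ge0_integralZr//.
  apply: ge0_le_integral => //.
  - by move=> x _; rewrite mule_ge0 ?poweR_ge0.
  - by apply: emeasurable_funM => //; exact: measurable_fun_poweR.
  - by apply: emeasurable_funM.
  by move=> x _; rewrite poweRe1// lee_wpmul2l.
have pd : (0 < n.+2%:R^-1 :> R)%R by rewrite invr_gt0.
have tE : (1 - n.+2%:R^-1 = n.+1%:R / n.+2%:R :> R)%R.
  have k0 : (n.+2%:R != 0 :> R)%R by rewrite pnatr_eq0.
  apply: (mulIf k0); rewrite divfK// mulrBl mul1r mulVf//.
  by rewrite -[n.+2]addn1 natrD addrK.
have tE2 : ((n.+2%:R / n.+1%:R) * (1 - n.+2%:R^-1) = 1 :> R)%R.
  by rewrite tE mulrA divfK// divff.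
have Iw0 : 0 <= \int[lebesgue_rV n.+2]_x w x `^ (n.+2%:R / n.+1%:R).
  by apply: integral_ge0 => x _; exact: poweR_ge0.
apply: (@le_trans _ _ ((\int[lebesgue_rV n.+2]_x F x) `^ (n.+2%:R^-1) *
   (\int[lebesgue_rV n.+2]_x w x `^ (n.+2%:R / n.+1%:R)) `^ (1 - n.+2%:R^-1))).
  apply: le_trans (hoelder_poweR _ _ _ _ _ _) => //.
  - apply: ge0_le_integral => //.
    + by move=> x _; rewrite mule_ge0 ?poweR_ge0.
    + by apply: emeasurable_funM => //; exact: measurable_fun_poweR.
    + by apply: emeasurable_funM => //; do ?exact: measurable_fun_poweR;
        exact/measurable_fun_poweR/measurable_fun_poweR.
    by move=> x _; rewrite -poweRrM tE2 poweRe1.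
  - by rewrite ltW//= invf_le1// ler1n.
  - exact: measurable_fun_poweR.
  - by move=> x; exact: poweR_ge0.
rewrite lee_wpmul2l ?poweR_ge0//.
have Ig0 : 0 <= \int[lebesgue_rV n.+2]_x g x by exact: integral_ge0.
have -> : \int[lebesgue_rV n.+2]_x g x =
    ((\int[lebesgue_rV n.+2]_x g x) `^ (n.+2%:R / n.+1%:R))
      `^ (1 - n.+2%:R^-1).
  by rewrite -poweRrM tE2 poweRe1.
rewrite gt0_ler_poweR ?tE ?divr_ge0//.
- by rewrite in_itv/= Iw0 leey.
- by rewrite in_itv/= poweR_ge0 leey.
exact: gagliardo_primal.
Qed.

(** With N = n + 2 this is the Sobolev inequality for integrable gradients, in a
    form without derivatives: it applies to functions that are cut off abruptly
    at the boundary of a half-space. *)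
Theorem gagliardo n (w g : 'rV[R]_n.+2 -> \bar R) :
  measurable_fun setT w -> measurable_fun setT g ->
  (forall x, 0 <= w x) -> (forall x, 0 <= g x) ->
  line_bounded w g ->
  \int[lebesgue_rV n.+2]_x (w x `^ (n.+2%:R / n.+1%:R)) <=
  (\int[lebesgue_rV n.+2]_x g x) `^ (n.+2%:R / n.+1%:R).
Proof. exact/gagliardo_primal/gagliardo_dual. Qed.

End gagliardo.

(** * Calculus on the line *)

Section signed_power.
Context {R : realType}.

Lemma is_derive_powR (r x : R) : 0 < x ->
  is_derive x 1 (fun y : R => y `^ r) (r * x `^ (r - 1)).
Proof.
move=> x0; have xin : x \in `]0, +oo[ by rewrite in_itv/= x0.
apply: DeriveDef; first exact: derivable_powR.
by rewrite -derive1E powR_derive1.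
Qed.

Lemma continuous_at_powR (r x : R) : 0 < x ->
  {for x, continuous (fun y : R => y `^ r)}.
Proof.
move=> x0; apply: differentiable_continuous; apply/derivable1_diffP.
by apply: derivable_powR; rewrite in_itv/= x0.
Qed.

(** Up to the factor [r + 1], this is the derivative of the power [r + 1] of the
    absolute value: its continuity is what makes that power of a continuously
    differentiable function continuously differentiable across its zeros. *)
Lemma continuous_signed_powR (r : R) : 0 < r ->
  continuous (fun x : R => `|x| `^ r * Num.sg x).
Proof.
move=> r0; set S := fun x : R => _.
have pos (x : R) : 0 < x -> {for x, continuous S}.
  move=> x0; rewrite /prop_for /continuous_at.
  rewrite (_ : S x = x `^ r); last by rewrite /S gtr0_norm// gtr0_sg// mulr1.
  apply: cvg_trans (continuous_at_powR x0); apply: near_eq_cvg; near=> y.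
  have y0 : 0 < y by near: y; exact: lt_nbhsr.
  by rewrite /S gtr0_norm// gtr0_sg// mulr1.
have SN x : S (- x) = - S x by rewrite /S normrN sgrN mulrN.
move=> x; have [x0|x0|<-] := ltgtP 0 x; first exact: pos.
- rewrite (_ : S = - (S \o -%R)); last first.
    by apply/funext => y; transitivity (- S (- y)); rewrite // SN opprK.
  apply: cvgN; apply: continuous_comp; first exact: opp_continuous.
  by apply: pos; rewrite oppr_gt0.
- rewrite /continuous_at; apply/cvgrPdist_lt => e e0.
  near=> y; rewrite /S sgr0 mulr0 sub0r normrN normrM ger0_norm ?powR_ge0//.
  have ye : `|y| < e `^ r^-1.
    near: y; exists (e `^ r^-1); first exact: powR_gt0.
    by move=> z /=; rewrite sub0r normrN.
  apply: (@le_lt_trans _ _ (`|y| `^ r)).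
    by rewrite -[leRHS]mulr1 ler_wpM2l ?powR_ge0// normr_sg; case: (_ == _).
  have -> : e = (e `^ r^-1) `^ r.
    by rewrite -powRrM mulVf ?gt_eqF// powRr1// ltW.
  by apply: gt0_ltr_powR => //; rewrite nnegrE// powR_ge0.
Unshelve. all: by end_near. Qed.

Lemma is_derive_norm_powR (q x : R) : 1 < q ->
  is_derive x 1 (fun y : R => `|y| `^ q) (q * (`|x| `^ (q - 1) * Num.sg x)).
Proof.
move=> q1; have q0 : 0 < q - 1 by rewrite subr_gt0.
have pos (y : R) : 0 < y ->
    is_derive y 1 (fun y : R => `|y| `^ q) (q * (`|y| `^ (q - 1) * Num.sg y)).
  move=> y0; rewrite gtr0_sg// mulr1 (gtr0_norm y0).
  apply: near_eq_is_derive (is_derive_powR q y0); near=> z.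
  by rewrite gtr0_norm//; near: z; exact: lt_nbhsr.
have [x0|x0|<-] := ltgtP 0 x; first exact: pos.
- have x0' : 0 < - x by rewrite oppr_gt0.
  have := is_derive1_comp (pos _ x0') (is_deriveN (is_derive_id x (1 : R))).
  rewrite normrN sgrN !mulrN mulNr mulr1 opprK.
  rewrite (_ : _ \o _ = fun y : R => `|y| `^ q)//.
  by apply/funext => y /=; rewrite normrN.
- rewrite sgr0 mulr0 mulr0.
  (* the difference quotient at 0 is the signed power of exponent q - 1 *)
  have cv : h^-1 *: (`|h *: (1 : R) + 0| `^ q - `|0 : R| `^ q)
      @[h --> (0 : R)^'] --> (0 : R).
    have := @continuous_signed_powR _ q0 (0 : R).
    move=> /continuous_withinNx; rewrite sgr0 mulr0; apply: cvg_trans.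
    apply: near_eq_cvg; near=> h.
    have h0 : h != 0 by near: h; exact: nbhs_dnbhs_neq.
    rewrite normr0 powR0 ?subr0 ?addr0; last first.
      by rewrite gt_eqF// (lt_trans _ q1).
    have qE : `|h| `^ q = `|h| `^ (q - 1) * `|h|.
      rewrite -[X in _ * X]powRr1// -powRD ?subrK// gt_eqF//.
      exact: lt_trans q1.
    rewrite [h *: 1]mulr1 [RHS]mulrC qE -mulrA; congr (_ * _).
    by rewrite [in RHS]normrEsg mulfK.
  apply: DeriveDef; first by apply/cvg_ex; exists 0.
  exact/cvg_lim.
Unshelve. all: by end_near. Qed.

Lemma continuous_norm_powR (q : R) : 1 < q ->
  continuous (fun t : R => `|t| `^ q).
Proof.
move=> q1 t; apply: differentiable_continuous; apply/derivable1_diffP.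
by have [] := is_derive_norm_powR t q1.
Qed.

End signed_power.

Section decay.
Context {R : realType}.
Local Notation lambda := (@lebesgue_measure R).

Lemma derive_FTC (F F' : R -> R) (a M : R) : a < M ->
  (forall t, a <= t -> is_derive t 1 F (F' t)) ->
  (forall t, a <= t -> {for t, continuous F'}) ->
  (lambda.-integrable `[a, M] (EFin \o F')) /\
  (\int[lambda]_(t in `[a, M]) (F' t)%:E = (F M - F a)%:E)%E.
Proof.
move=> aM dF cF.
have cw : {within `[a, M], continuous F'}.
  apply: continuous_in_subspaceT => t; rewrite inE/= in_itv/= => /andP[at_ _].
  exact: cF.
split.
  by apply: continuous_compact_integrable => //; exact: segment_compact.
rewrite (@continuous_FTC2 _ F' F _ _ aM cw)//.
- have cFt t : a <= t -> {for t, continuous F}.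
    move=> at_; apply: differentiable_continuous; apply/derivable1_diffP.
    by have [] := dF _ at_.
  split.
  + by move=> t /[!in_itv]/= /andP[at_ _]; have [] := dF _ (ltW at_).
  + apply: cvg_at_right_filter; exact: cFt.
  + apply: cvg_at_left_filter; apply: cFt; exact: ltW.
- move=> t; rewrite in_itv/= => /andP[at_ _]; rewrite derive1E.
  by have [] := dF _ (ltW at_).
Qed.

(** [F a] is recovered by integrating back from the zero [M] of [F], so that [a]
    may come arbitrarily close to the boundary of a half-line, where [F] need
    not vanish. *)
Lemma decay_le_integral (F F' g : R -> R) (a M : R) : a < M ->
  (forall t, a <= t -> is_derive t 1 F (F' t)) ->
  (forall t, a <= t -> {for t, continuous F'}) ->
  F M = 0 -> measurable_fun setT g ->
  (forall t, a <= t -> `|F' t| <= g t) ->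
  ((F a)%:E <= \int[lambda]_(t in `[a, M]) (g t)%:E)%E.
Proof.
move=> aM dF cF FM mg Fg; have [iF FE] := derive_FTC aM dF cF.
have /integrableP[mF _] := iF.
apply: (@le_trans _ _ `|\int[lambda]_(t in `[a, M]) (F' t)%:E|%E).
  by rewrite FE FM sub0r /= lee_fin normrN ler_norm.
apply: le_trans (le_abse_integral _ _ mF) _ => //.
apply: ge0_le_integral => //.
- exact: measurableT_comp.
- by apply/measurable_EFinP; exact: measurable_funTS.
- by move=> t /=; rewrite in_itv/= => /andP[at_ _]; rewrite lee_fin Fg.
Qed.

End decay.

(** * Hardy's inequality and decay on a half-line *)

(** The sign is a parameter because the reflection that exchanges the two
    half-lines reduces every statement to the positive one, [b = false]. *)
Definition half_line {R : realType} (b : bool) : set R :=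
  [set t | 0 < (-1) ^+ b * t].

Section half_lines.
Context {R : realType}.
Local Notation lambda := (@lebesgue_measure R).

Lemma half_line_false : half_line false = `]0, +oo[%classic :> set R.
Proof.
by apply/seteqP; split => t; rewrite /half_line /= in_itv/= andbT expr0 mul1r.
Qed.

Lemma measurable_half_line b :
  measurable (half_line b : set (measurableTypeR R)).
Proof.
have mo : measurable_fun setT
    (fun t : measurableTypeR R => (-1) ^+ b * t : measurableTypeR R).
  exact: measurable_funM.
rewrite (_ : half_line b = [set: measurableTypeR R] `&`
    (fun t : measurableTypeR R => (-1) ^+ b * t : measurableTypeR R)
      @^-1` `]0, +oo[%classic).
  exact: mo.
by rewrite setTI; apply/seteqP; split => t /=; rewrite in_itv/= andbT.
Qed.

Lemma integral_half_line b (G : R -> \bar R) :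
  measurable_fun [set: R] G -> (forall t, (0 <= G t)%E) ->
  (\int[lambda]_(t in half_line b) G t =
   \int[lambda]_(t in `]0%R, +oo[) G ((-1) ^+ b * t)%R)%E.
Proof.
move=> mG G0; rewrite -half_line_false; case: b; last first.
  by apply: eq_integral => t _; rewrite ?expr0 mul1r.
have mN : measurable_fun [set: R] (fun t => G (- t)%R).
  by apply: measurableT_comp => //; exact: measurable_funN.
have hN : half_line true =
    (-%R : _ -> measurableTypeR R) @^-1` half_line false :> set R.
  by apply/seteqP; split => t; rewrite /half_line /= expr0 mul1r expr1 mulN1r.
transitivity (\int[pushforward lambda
    (-%R : _ -> measurableTypeR R)]_(t in half_line false) G (- t)%R)%E.
  rewrite ge0_integral_pushforward//=.
  - by rewrite hN; apply: eq_integral => t _ /=; rewrite opprK.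
  - exact: measurable_half_line.
  - exact: measurable_funTS.
under [RHS]eq_integral do rewrite ?expr1 mulN1r.
apply: eq_measure_integral => A mA _; exact: lebesgue_measureN.
Qed.

End half_lines.

Section hardy.
Context {R : realType}.
Local Notation lambda := (@lebesgue_measure R).
Variables (f f' : R -> R) (M : R).
Hypotheses (df : forall t : R, is_derive t 1 f (f' t)) (cf' : continuous f')
  (f0 : forall t, M <= `|t| -> f t = 0).

Let cf : continuous f.
Proof.
move=> t; apply: differentiable_continuous; apply/derivable1_diffP.
by have [] := df t.
Qed.

Let mf : measurable_fun [set: R] f.
Proof. exact: continuous_measurable_fun. Qed.

Let mf' : measurable_fun [set: R] f'.
Proof. exact: continuous_measurable_fun. Qed.

(** With k = 2 alpha - 1, the derivative of t ^ k * f ^ 2 plus the right-hand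
    integrand minus the left-hand one is a multiple of the square of
    f + 2 / k * t * f', hence nonnegative. The boundary terms t ^ k * f ^ 2
    vanish at [b] and have the favorable sign at [a], whatever the value of [f]
    there. No integral is moved from one side to the other, so that the
    inequality is still meaningful when they are infinite in the limit. *)
Lemma hardy_segment (k a b : R) : 0 < k -> 0 < a -> a < b -> M <= b ->
  (\int[lambda]_(t in `[a, b]) (k / 2 * (t `^ (k - 1) * f t ^+ 2))%:E <=
   \int[lambda]_(t in `[a, b]) (2 / k * (t `^ (k + 1) * f' t ^+ 2))%:E)%E.
Proof.
move=> k0 a0 ab Mb.
have b0 : 0 < b := lt_trans a0 ab.
have k2 : 0 <= k / 2 by rewrite divr_ge0// ltW.
pose F t := t `^ k * f t ^+ 2.
pose F' t := k * t `^ (k - 1) * f t ^+ 2 + t `^ k * (2 * f t * f' t).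
pose B t := 2 / k * (t `^ (k + 1) * f' t ^+ 2).
have t0 t : a <= t -> 0 < t by exact: lt_le_trans.
have dF t : a <= t -> is_derive t 1 F (F' t).
  move=> /t0 {}t0; have h1 := is_derive_powR k t0.
  have h2 := is_deriveX 2 (df t).
  apply: (is_derive_eq (is_deriveM h1 h2)).
  transitivity (t `^ k * (2 * f t * f' t) + f t * f t * (k * t `^ (k - 1))) => //.
  by rewrite /F'; ring.
have cp (r t : R) : a <= t -> {for t, continuous (fun t => t `^ r)}.
  by move=> /t0; exact: continuous_at_powR.
have csq (g : R -> R) : continuous g -> continuous (fun t => g t ^+ 2).
  by move=> cg t; exact: (continuousM (cg t) (cg t)).
have cF' t : a <= t -> {for t, continuous F'}.
  move=> at_; apply: continuousD; apply: continuousM.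
  - by apply: continuousM; [exact: cst_continuous|exact: cp].
  - exact: csq.
  - exact: cp.
  - apply: continuousM; last exact: cf'.
    by apply: continuousM; [exact: cst_continuous|exact: cf].
have cB t : a <= t -> {for t, continuous B}.
  move=> at_; apply: continuousM; first exact: cst_continuous.
  by apply: continuousM; [exact: cp|exact: csq].
have iB : lambda.-integrable `[a, b] (EFin \o B).
  apply: continuous_compact_integrable; first exact: segment_compact.
  apply: continuous_in_subspaceT => t; rewrite inE/= in_itv/= => /andP[at_ _].
  exact: cB.
have [iF FE] := derive_FTC ab dF cF'.
have Fb : F b = 0 by rewrite /F f0 ?expr0n ?mulr0// gtr0_norm.
apply: (@le_trans _ _ (\int[lambda]_(t in `[a, b]) ((B t)%:E + (F' t)%:E))%E).
  apply: ge0_le_integral => //.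
  - move=> t _; by rewrite lee_fin mulr_ge0// mulr_ge0 ?powR_ge0 ?sqr_ge0.
  - apply/measurable_EFinP; apply: measurable_funTS; apply: measurable_funM => //.
    by apply: measurable_funM => //; exact: measurable_funX.
  - by apply: emeasurable_funD; [case/integrableP: iB|case/integrableP: iF].
  move=> t /=; rewrite in_itv/= => /andP[/t0 {}t0 _].
  rewrite -EFinD lee_fin -subr_ge0.
  have p1 : t `^ k = t `^ (k - 1) * t.
    by rewrite -[X in _ * X]powRr1 ?ltW// -powRD ?subrK// (gt_eqF k0).
  have p2 : t `^ (k + 1) = t `^ (k - 1) * t ^+ 2.
    rewrite powRD; last by rewrite (gt_eqF t0) implybT.
    by rewrite p1 powRr1 ?ltW// expr2 mulrA.
  rewrite /B /F' p1 p2.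
  rewrite (_ : _ - _ =
    t `^ (k - 1) * (k / 2 * (f t + 2 / k * (t * f' t)) ^+ 2)).
    by rewrite mulr_ge0 ?powR_ge0// mulr_ge0 ?sqr_ge0.
  by field; rewrite gt_eqF.
rewrite integralD// FE Fb sub0r geeDl// lee_fin oppr_le0 /F.
by rewrite mulr_ge0 ?powR_ge0 ?sqr_ge0.
Qed.

(** The constant of the segments is uniform: let them exhaust the half-line. *)
Lemma hardy_ray (k : R) : 0 < k ->
  (\int[lambda]_(t in `]0%R, +oo[) (k / 2 * (t `^ (k - 1) * f t ^+ 2))%:E <=
   \int[lambda]_(t in `]0%R, +oo[) (2 / k * (t `^ (k + 1) * f' t ^+ 2))%:E)%E.
Proof.
move=> k0.
have k2 : 0 <= k / 2 by rewrite divr_ge0// ltW.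
have k2' : 0 <= 2 / k by rewrite divr_ge0// ltW.
set A := fun t => (k / 2 * (t `^ (k - 1) * f t ^+ 2))%:E.
set B := fun t => (2 / k * (t `^ (k + 1) * f' t ^+ 2))%:E.
have mA : measurable_fun [set: R] A.
  apply/measurable_EFinP; apply: measurable_funM => //.
  by apply: measurable_funM => //; exact: measurable_funX.
have mB : measurable_fun [set: R] B.
  apply/measurable_EFinP; apply: measurable_funM => //.
  by apply: measurable_funM => //; exact: measurable_funX.
have A0 t : (0 <= A t)%E.
  by rewrite lee_fin mulr_ge0// mulr_ge0 ?powR_ge0 ?sqr_ge0.
have B0 t : (0 <= B t)%E.
  by rewrite lee_fin mulr_ge0// mulr_ge0 ?powR_ge0 ?sqr_ge0.
pose I (n : nat) : set R := `[n.+1%:R^-1, `|M| + n.+2%:R]%classic.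
have UI : `]0, +oo[%classic = \bigcup_n I n.
  apply/seteqP; split => t /=; rewrite in_itv/= andbT; last first.
    move=> [n _]; rewrite /I/= in_itv/= => /andP[nt _].
    by apply: lt_le_trans nt; rewrite invr_gt0.
  move=> t0.
  have [n1 _ h1] := near_infty_natSinv_lt (PosNum t0).
  pose n2 := Num.truncn t.
  exists (maxn n1 n2) => //; rewrite /I/= in_itv/=; apply/andP; split.
    by apply/ltW; have := h1 _ (leq_maxl n1 n2).
  apply/ltW; apply: (lt_le_trans (truncnS_gt t)).
  by rewrite ler_wpDl// ler_nat ltnW// !ltnS leq_maxr.
have : (\int[lambda]_(x in I i) A x)%E @[i --> \oo] -->
    (\int[lambda]_(x in `]0%R, +oo[) A x)%E.
  rewrite UI; apply: ge0_nondecreasing_set_cvg_integral => //.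
  - move=> n m nm; apply/subsetPset => t; rewrite /I/= !in_itv/= => /andP[h1 h2].
    apply/andP; split.
      by apply: le_trans h1; rewrite lef_pV2 ?posrE// ler_nat.
    by apply: le_trans h2 _; rewrite lerD2l ler_nat.
  - by move=> n; exact: measurable_itv.
  - by move=> n; exact: measurable_funTS.
move=> /cvg_lim <- //; apply: lime_le.
  apply: ereal_nondecreasing_is_cvgn => n m nm; apply: ge0_subset_integral => //.
  - exact: measurable_itv.
  - exact: measurable_itv.
  - exact: measurable_funTS.
  move=> t; rewrite /I/= !in_itv/= => /andP[h1 h2]; apply/andP; split.
    by apply: le_trans h1; rewrite lef_pV2 ?posrE// ler_nat.
  by apply: le_trans h2 _; rewrite lerD2l ler_nat.
near=> n.
have ab : n.+1%:R^-1 < `|M| + n.+2%:R :> R.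
  apply: (@le_lt_trans _ _ 1); first by rewrite invf_le1// ler1n.
  by rewrite ltr_wpDl// ltr1n.
apply: (@le_trans _ _ (\int[lambda]_(t in I n) B t)%E).
  apply: hardy_segment => //.
  by rewrite (le_trans (ler_norm M))// lerDl.
rewrite UI; apply: ge0_subset_integral => //.
- exact: measurable_itv.
- by rewrite -UI; exact: measurable_itv.
- exact: measurable_funTS.
- exact: bigcup_sup.
Unshelve. all: by end_near. Qed.


(** The line version of the decay bound, for the directions tangent to the
    boundary of a half-space, along which the weight is constant. *)
Lemma norm_powR_le_integral_line (q t0 : R) : 1 < q ->
  ((`|f t0| `^ q)%:E <=
   \int[lambda]_t (q * `|f t| `^ (q - 1) * `|f' t|)%:E)%E.
Proof.
move=> q1; have q0 : 0 < q by exact: lt_trans q1.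
pose F t := `|f t| `^ q.
pose F' t := q * (`|f t| `^ (q - 1) * Num.sg (f t)) * f' t.
pose b := `|M| + `|t0| + 1.
have t0b : t0 < b.
  by rewrite /b (le_lt_trans (ler_norm t0))// -addrA ltr_wpDl// ltrDl.
have Mb : M <= `|b|.
  rewrite (@ger0_norm _ b); last by rewrite /b !addr_ge0.
  by rewrite /b (le_trans (ler_norm M))// -addrA lerDl addr_ge0.
have mg : measurable_fun [set: R] (fun t => q * `|f t| `^ (q - 1) * `|f' t|).
  apply: measurable_funM; last exact: measurableT_comp.
  apply: measurable_funM => //.
  by apply: measurable_fun_powR; exact: measurableT_comp.
apply: le_trans (@decay_le_integral _ F F'
  (fun t => q * `|f t| `^ (q - 1) * `|f' t|) t0 b t0b _ _ _ _ _) _ => //.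
- by move=> t _; exact: (is_derive1_comp (is_derive_norm_powR (f t) q1) (df t)).
- move=> t _; apply: continuousM; last exact: cf'.
  apply: continuousM; first exact: cst_continuous.
  apply: (@continuous_comp _ _ _ f (fun x => `|x| `^ (q - 1) * Num.sg x)).
    exact: cf.
  by apply: continuous_signed_powR; rewrite subr_gt0.
- by rewrite /F f0// normr0 powR0// gt_eqF.
- move=> t _; rewrite /F' !normrM (gtr0_norm q0) ler_wpM2r// ler_wpM2l ?(ltW q0)//.
  rewrite (ger0_norm (powR_ge0 _ _)) -[leRHS]mulr1 ler_wpM2l ?powR_ge0//.
  by rewrite normr_sg; case: (_ == _).
apply: ge0_subset_integral => //.
  exact/measurable_EFinP.
by move=> t _; rewrite lee_fin !mulr_ge0 ?powR_ge0// ltW.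
Qed.

(** For the direction normal to the boundary, the weight is differentiated too:
    this produces the second term of the last factor, which Hardy's inequality
    controls. *)
Lemma weighted_ray (q alpha t0 : R) : 1 < q -> 0 < alpha -> 0 < t0 ->
  (((t0 `^ alpha * `|f t0|) `^ q)%:E <=
   \int[lambda]_(t in `]0%R, +oo[) (q * (t `^ alpha * `|f t|) `^ (q - 1) *
     (t `^ alpha * `|f' t| + alpha * t `^ (alpha - 1) * `|f t|))%:E)%E.
Proof.
move=> q1 al0 t0p; have q0 : 0 < q by exact: lt_trans q1.
pose g t := q * (t `^ alpha * `|f t|) `^ (q - 1) *
     (t `^ alpha * `|f' t| + alpha * t `^ (alpha - 1) * `|f t|).
pose F t := t `^ (alpha * q) * `|f t| `^ q.
pose F' t :=
  t `^ (alpha * q) * (q * (`|f t| `^ (q - 1) * Num.sg (f t)) * f' t) +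
  `|f t| `^ q * (alpha * q * t `^ (alpha * q - 1)).
pose b := `|M| + `|t0| + 1.
have t0b : t0 < b.
  by rewrite /b (le_lt_trans (ler_norm t0))// -addrA ltr_wpDl// ltrDl.
have Mb : M <= `|b|.
  rewrite (@ger0_norm _ b); last by rewrite /b !addr_ge0.
  by rewrite /b (le_trans (ler_norm M))// -addrA lerDl addr_ge0.
have mnf : measurable_fun [set: R] (fun t => `|f t|) by exact: measurableT_comp.
have mnf' : measurable_fun [set: R] (fun t => `|f' t|).
  exact: measurableT_comp.
have mg : measurable_fun [set: R] g.
  apply: measurable_funM.
    apply: measurable_funM => //; apply: measurable_fun_powR.
    exact: measurable_funM.
  apply: measurable_funD; apply: measurable_funM => //.
  exact: measurable_funM.
have pos t : t0 <= t -> 0 < t by exact: lt_le_trans.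
have g0 t : 0 <= g t.
  rewrite /g mulr_ge0//; first by rewrite mulr_ge0 ?powR_ge0// ltW.
  by rewrite addr_ge0// mulr_ge0 ?powR_ge0// mulr_ge0 ?powR_ge0// ltW.
have FE t : 0 < t -> F t = (t `^ alpha * `|f t|) `^ q.
  by move=> tp; rewrite powRM ?powR_ge0// -powRrM.
rewrite -FE//.
apply: le_trans (@decay_le_integral _ F F' g t0 b t0b _ _ _ mg _) _ => //.
- move=> t /pos tp.
  have h1 := is_derive_powR (alpha * q) tp.
  have h2 := is_derive1_comp (is_derive_norm_powR (f t) q1) (df t).
  exact: (is_deriveM h1 h2).
- move=> t /pos tp; apply: continuousD; apply: continuousM.
  + exact: continuous_at_powR.
  + apply: continuousM; last exact: cf'.
    apply: continuousM; first exact: cst_continuous.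
    apply: (@continuous_comp _ _ _ f (fun x => `|x| `^ (q - 1) * Num.sg x)).
      exact: cf.
    by apply: continuous_signed_powR; rewrite subr_gt0.
  + apply: (@continuous_comp _ _ _ f (fun x => `|x| `^ q)); first exact: cf.
    exact: continuous_norm_powR.
  + apply: continuousM; first exact: cst_continuous.
    exact: continuous_at_powR.
- by rewrite /F f0// normr0 powR0 ?mulr0// gt_eqF.
- move=> t /pos tp; rewrite /F' (le_trans (ler_normD _ _))//.
  have p1 : t `^ (alpha * q) = t `^ (alpha * (q - 1)) * t `^ alpha.
    rewrite -powRD; first by congr (_ `^ _); ring.
    by rewrite (gt_eqF tp) implybT.
  have p2 : t `^ (alpha * q - 1) = t `^ (alpha * (q - 1)) * t `^ (alpha - 1).
    rewrite -powRD; first by congr (_ `^ _); ring.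
    by rewrite (gt_eqF tp) implybT.
  have p3 : `|f t| `^ q = `|f t| `^ (q - 1) * `|f t|.
    by rewrite -[X in _ * X]powRr1// -powRD ?subrK// gt_eqF.
  rewrite /g powRM ?powR_ge0// -powRrM p1 p2 p3.
  rewrite !normrM !(ger0_norm (powR_ge0 _ _)) normr_id.
  rewrite (gtr0_norm q0) (gtr0_norm al0).
  rewrite [leRHS]mulrDr; apply: lerD; last first.
    by rewrite le_eqVlt; apply/orP; left; apply/eqP; ring.
  have sg1 : `|Num.sg (f t)| <= 1 by rewrite normr_sg; case: (_ == _).
  rewrite [leLHS](_ : _ = q * (t `^ (alpha * (q - 1)) * `|f t| `^ (q - 1)) *
     (t `^ alpha * `|f' t|) * `|Num.sg (f t)|); last by ring.
  rewrite -[leRHS]mulr1 ler_wpM2l// !mulr_ge0 ?powR_ge0//; exact: ltW.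
apply: ge0_subset_integral => //.
- by apply/measurable_EFinP; exact: measurable_funTS.
- by move=> t _; rewrite lee_fin.
by move=> t; rewrite /= !in_itv/= andbT => /andP[/pos].
Qed.

End hardy.

Section half_line_inequalities.
Context {R : realType}.
Local Notation lambda := (@lebesgue_measure R).
Variables (f f' : R -> R) (M : R).
Hypotheses (df : forall t : R, is_derive t 1 f (f' t)) (cf' : continuous f')
  (f0 : forall t, M <= `|t| -> f t = 0).


Let sg (b : bool) (t : R) : R := (-1) ^+ b * t.

Let dfs b (t : R) : is_derive t 1 (f \o sg b) ((-1) ^+ b * f' (sg b t)).
Proof.
rewrite [X in is_derive _ _ _ X]mulrC.
have h : is_derive t 1 (sg b) ((-1) ^+ b).
  apply: (is_derive_eq (is_deriveZ ((-1) ^+ b) (is_derive_id t (1 : R)))).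
  exact: mulr1.
exact: (is_derive1_comp (df (sg b t)) h).
Qed.

Let csg b : continuous (sg b).
Proof. by rewrite /sg => t; apply: cvgM; [exact: cvg_cst|exact: cvg_id]. Qed.

Let cfs' (b : bool) : continuous (fun t : R => (-1) ^+ b * f' (sg b t)).
Proof.
move=> t; apply: cvgM; first exact: cvg_cst.
by apply: (@continuous_comp _ _ _ (sg b) f'); [exact: csg|exact: cf'].
Qed.

Let norm_sg b t : `|sg b t| = `|t|.
Proof. by rewrite normrMsign. Qed.

Let f0s b t : M <= `|t| -> (f \o sg b) t = 0.
Proof. by move=> Mt; apply: f0; rewrite norm_sg. Qed.

Let mf : measurable_fun [set: R] f.
Proof.
apply: continuous_measurable_fun => t; apply: differentiable_continuous.
by apply/derivable1_diffP; have [] := df t.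
Qed.

Let mf' : measurable_fun [set: R] f'.
Proof. exact: continuous_measurable_fun. Qed.

Let mnpow (h : R -> R) r : measurable_fun [set: R] h ->
  measurable_fun [set: R] (fun t => `|h t| `^ r).
Proof.
by move=> mh; apply: measurable_fun_powR; exact: measurableT_comp.
Qed.

Lemma hardy_half_line (b : bool) (alpha : R) : 1 / 2 < alpha ->
  (\int[lambda]_(t in half_line b) (`|t| `^ (2 * alpha - 2) * f t ^+ 2)%:E <=
   ((2 / (2 * alpha - 1)) ^+ 2)%:E *
   \int[lambda]_(t in half_line b) (`|t| `^ (2 * alpha) * f' t ^+ 2)%:E)%E.
Proof.
move=> al; have k0 : 0 < 2 * alpha - 1 by lra.
have mm (h : R -> R) r : measurable_fun [set: R] h ->
    measurable_fun [set: R] (fun t => (`|t| `^ r * h t ^+ 2)%:E).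
  move=> mh; apply/measurable_EFinP; apply: measurable_funM.
    exact: mnpow.
  exact: measurable_funX.
have p0 r (h : R -> R) t : (0 <= (`|t| `^ r * h t ^+ 2)%:E)%E.
  by rewrite lee_fin mulr_ge0 ?powR_ge0 ?sqr_ge0.
rewrite !integral_half_line//; do ?exact: mm.
have := hardy_ray (dfs b) (@cfs' b) (@f0s b) k0.
set k := 2 * alpha - 1.
have posP (t : R) : t \in `]0, +oo[%classic -> `|t| = t.
  by rewrite inE/= in_itv/= andbT => /gtr0_norm.
have -> : (\int[lambda]_(t in `]0%R, +oo[)
   (k / 2 * (t `^ (k - 1) * (f \o sg b) t ^+ 2))%:E =
   (k / 2)%:E * \int[lambda]_(t in `]0%R, +oo[)
     (`|sg b t| `^ (2 * alpha - 2) * f (sg b t) ^+ 2)%:E)%E.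
  rewrite -ge0_integralZl//.
  - apply: eq_integral => t /posP tE; rewrite norm_sg tE -EFinM.
    by rewrite (_ : k - 1 = 2 * alpha - 2)// /k; ring.
  - apply: measurable_funTS; apply: (measurableT_comp (mm _ (2 * alpha - 2) mf)).
    exact: continuous_measurable_fun.
  - by rewrite lee_fin divr_ge0// ltW.
have -> : (\int[lambda]_(t in `]0%R, +oo[)
   (2 / k * (t `^ (k + 1) * ((-1) ^+ b * f' (sg b t)) ^+ 2))%:E =
   (2 / k)%:E * \int[lambda]_(t in `]0%R, +oo[)
     (`|sg b t| `^ (2 * alpha) * f' (sg b t) ^+ 2)%:E)%E.
  rewrite -ge0_integralZl//.
  - apply: eq_integral => t /posP tE; rewrite norm_sg tE -EFinM.
    rewrite exprMn sqrr_sign mul1r.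
    by rewrite (_ : k + 1 = 2 * alpha)// /k; ring.
  - apply: measurable_funTS; apply: (measurableT_comp (mm _ (2 * alpha) mf')).
    exact: continuous_measurable_fun.
  - by rewrite lee_fin divr_ge0// ltW.
move=> h; have k2 : (0 <= (2 / k)%:E)%E by rewrite lee_fin divr_ge0// ltW.
have := lee_wpmul2l k2 h; rewrite !muleA -!EFinM -expr2.
by rewrite (_ : 2 / k * (k / 2) = 1) ?mul1e//; field; rewrite gt_eqF.
Qed.

Lemma weighted_power_le_integral (b : bool) (q alpha t0 : R) :
  1 < q -> 0 < alpha -> half_line b t0 ->
  (((`|t0| `^ alpha * `|f t0|) `^ q)%:E <=
   \int[lambda]_(t in half_line b) (q * (`|t| `^ alpha * `|f t|) `^ (q - 1) *
     (`|t| `^ alpha * `|f' t| + alpha * `|t| `^ (alpha - 1) * `|f t|))%:E)%E.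
Proof.
move=> q1 al0 bt0; have q0 : 0 < q by exact: lt_trans q1.
rewrite integral_half_line; last 2 first.
- apply/measurable_EFinP; apply: measurable_funM.
    apply: measurable_funM => //; apply: measurable_fun_powR.
    apply: measurable_funM; [exact: mnpow|exact: measurableT_comp].
  apply: measurable_funD; apply: measurable_funM.
  + exact: mnpow.
  + exact: measurableT_comp.
  + by apply: measurable_funM => //; exact: mnpow.
  + exact: measurableT_comp.
- move=> t; rewrite lee_fin mulr_ge0//; first by rewrite mulr_ge0 ?powR_ge0// ltW.
  by rewrite addr_ge0// mulr_ge0 ?powR_ge0// mulr_ge0 ?powR_ge0// ltW.
have := weighted_ray (dfs b) (@cfs' b) (@f0s b) q1 al0 bt0.
have sgK : sg b ((-1) ^+ b * t0) = t0 by rewrite /sg mulrA -expr2 sqrr_sign mul1r.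
rewrite /= sgK.
have -> : ((-1) ^+ b * t0) `^ alpha = `|t0| `^ alpha.
  by rewrite -(gtr0_norm bt0) normrMsign.
move=> /le_trans; apply; rewrite le_eqVlt; apply/orP; left; apply/eqP.
apply: eq_integral => t; rewrite inE/= in_itv/= andbT => tp.
by rewrite normrMsign -/(sg b t) norm_sg (gtr0_norm tp).
Qed.

End half_line_inequalities.

(** * Smooth compactly supported functions along coordinate lines *)

Section regularity.
Context {R : realType} {n : nat}.
Implicit Types (u : 'rV[R]_n -> R) (x : 'rV[R]_n) (i : 'I_n).

Lemma rV_upd_id x i : rV_upd x i (x ord0 i) = x.
Proof. by apply/rowP => j; rewrite mxE; case: eqP => // ->. Qed.

Lemma continuous_rV_upd x i : continuous (rV_upd x i).
Proof.
move=> t; apply/cvg_ballP => e e0; near=> s; split => // k j.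
rewrite !mxE; case: ifP => _; last exact: ballxx.
by near: s; apply/nbhs_ballP; exists e.
Unshelve. all: by end_near. Qed.

Lemma rV_upd_shift x i (t h : R) :
  rV_upd x i (h *: 1 + t) = h *: basis_vec i + rV_upd x i t.
Proof.
apply/rowP => j; rewrite !mxE eqxx; case: eqP => /= _.
  by rewrite /GRing.scale/= !mulr1.
by rewrite /GRing.scale/= mulr0 add0r.
Qed.

Lemma is_derive_line u x i (t : R) : derivable u (rV_upd x i t) (basis_vec i) ->
  is_derive t 1 (fun t => u (rV_upd x i t)) (partial i u (rV_upd x i t)).
Proof.
have E : (fun h : R => h^-1 *: (((fun t => u (rV_upd x i t)) \o shift t)
      (h *: 1) - u (rV_upd x i t))) =
    (fun h : R => h^-1 *: ((u \o shift (rV_upd x i t))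
      (h *: basis_vec i) - u (rV_upd x i t))).
  by apply/funext => h; rewrite /= rV_upd_shift.
move=> du; apply: DeriveDef; first by rewrite /derivable E.
by rewrite /partial /derive E.
Qed.

Lemma coord_le_norm x i : `|x ord0 i| <= `|x|.
Proof.
rewrite [leRHS]mx_normrE.
exact: (le_bigmax _ (fun ij : 'I_1 * 'I_n => `|x ij.1 ij.2|) (ord0, i)).
Qed.

Lemma partial_le_enorm u x i : `|partial i u x| <= enorm (gradient u x).
Proof.
rewrite -sqrtr_sqr ler_wsqrtr// (bigD1 i)//= mxE lerDl.
by apply: sumr_ge0 => j _; exact: sqr_ge0.
Qed.

Lemma compact_support_box u : compact_support u ->
  exists M : R, forall x i, M <= `|x ord0 i| -> u x = 0.
Proof.
move=> /compact_bounded[M [_ HM]]; exists (M + 2) => x i Mx.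
apply/eqP; apply: contraT => ux.
have cx : closure [set x | u x != 0] x by exact: subset_closure.
have M1 : M < M + 1 by rewrite ltrDl.
have /= xM := HM _ M1 x cx.
have := le_trans Mx (le_trans (coord_le_norm x i) xM).
by rewrite lerD2l (ler_nat _ 2 1).
Qed.

Lemma compact_support_bounded u : continuous u -> compact_support u ->
  exists2 B : R, 0 <= B & forall x, `|u x| <= B.
Proof.
move=> cu cs.
have /compact_bounded[M [_ HM]] :
    compact (u @` closure [set x | u x != 0]).
  by apply: continuous_compact => //; exact: continuous_subspaceT.
exists (`|M| + 1); first by rewrite addr_ge0.
move=> x; have [->|ux] := eqVneq (u x) 0; first by rewrite normr0 addr_ge0.
apply: (HM (`|M| + 1)); first by rewrite (le_lt_trans (ler_norm M))// ltrDl.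
by exists x => //; exact: subset_closure.
Qed.

Lemma smooth_continuous u : smooth u -> continuous u.
Proof. by move=> /(_ [::])[]. Qed.

Lemma smooth_derivable u x i : smooth u -> derivable u x (basis_vec i).
Proof. by move=> /(_ [::])[_]; exact. Qed.

Lemma smooth_continuous_partial u i : smooth u -> continuous (partial i u).
Proof. by move=> /(_ [:: i])[]. Qed.

Lemma measurable_enorm_gradient u : smooth u ->
  measurable_fun [set: 'rV[R]_n] (fun x => enorm (gradient u x)).
Proof.
move=> su; rewrite (_ : (fun x => _) =
    fun x => (\sum_i partial i u x ^+ 2) `^ 2^-1); last first.
  apply/funext => x; rewrite powR12_sqrt; last first.
    by apply: sumr_ge0 => i _; exact: sqr_ge0.
  by rewrite /enorm; congr Num.sqrt; apply: eq_bigr => i _; rewrite mxE.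
apply: measurable_fun_powR; apply: measurable_sum => i.
apply: measurable_funX; apply: continuous_measurable_rV.
exact: smooth_continuous_partial.
Qed.

Lemma measurable_smooth u : smooth u -> measurable_fun [set: 'rV[R]_n] u.
Proof.
by move=> su; apply: continuous_measurable_rV; exact: smooth_continuous.
Qed.

End regularity.

(** * Weighted inequalities on a half-space *)

Definition half_space {R : realType} {n : nat} (b : bool) : set 'rV[R]_n.+1 :=
  [set x | half_line b (last_coord x)].

Section half_space.
Context {R : realType} {n : nat}.
Local Notation lambda := (@lebesgue_measure R).

Lemma measurable_half_space b :
  measurable (half_space b : set 'rV[R]_n.+1).
Proof.
rewrite -[X in measurable X]setTI; apply: measurable_coord => //.
exact: measurable_half_line.
Qed.

Lemma integral_half_space_line b (g : 'rV[R]_n.+1 -> \bar R) x :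
  (\int[lambda]_t (g \_ (half_space b)) (rV_upd x ord_max t) =
   \int[lambda]_(t in half_line b) g (rV_upd x ord_max t))%E.
Proof.
rewrite [RHS]integral_mkcond; apply: eq_integral => t _.
rewrite !patchE /half_space /=.
rewrite (_ : (rV_upd x ord_max t \in _) = (t \in half_line b))//.
by apply/idP/idP; rewrite !inE /half_space/= /last_coord mxE eqxx.
Qed.

Lemma half_space_upd b x (i : 'I_n.+1) (t : R) : i != ord_max ->
  (rV_upd x i t \in half_space b) = (x \in half_space b).
Proof.
move=> iN; rewrite /half_space /last_coord.
by apply/idP/idP; rewrite !inE/= mxE eq_sym (negbTE iN).
Qed.

Lemma le_integral_half_space b (f g : 'rV[R]_n.+1 -> \bar R) :
  measurable_fun setT f -> measurable_fun setT g ->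
  (forall x, (0 <= f x)%E) -> (forall x, (0 <= g x)%E) ->
  (forall x, (\int[lambda]_(t in half_line b) f (rV_upd x ord_max t) <=
     \int[lambda]_(t in half_line b) g (rV_upd x ord_max t))%E) ->
  (\int[lebesgue_rV n.+1]_(x in half_space b) f x <=
   \int[lebesgue_rV n.+1]_(x in half_space b) g x)%E.
Proof.
move=> mf mg f0 g0 fg; rewrite integral_mkcond [leRHS]integral_mkcond.
have r0 (h : 'rV[R]_n.+1 -> \bar R) : (forall x, (0 <= h x)%E) ->
    forall x, (0 <= (h \_ (half_space b)) x)%E.
  by move=> h0 x; rewrite patchE; case: ifPn.
have mr (h : 'rV[R]_n.+1 -> \bar R) : measurable_fun setT h ->
    measurable_fun setT (h \_ (half_space b)).
  move=> mh; apply/(measurable_restrictT _ (measurable_half_space b)).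
  exact: measurable_funTS.
apply: (le_integral_lines (i := ord_max)) => //;
  [exact: mr|exact: mr|exact: r0|exact: r0|].
by move=> x; rewrite !integral_half_space_line.
Qed.

Lemma half_space_last_coord b (x : 'rV[R]_n.+1) :
  half_space b x -> 0 < `|last_coord x|.
Proof.
rewrite /half_space /half_line/= => xb; rewrite normr_gt0.
by apply: contraTneq xb => ->; rewrite mulr0 ltxx.
Qed.

Lemma measurable_abs_last_coord :
  measurable_fun [set: 'rV[R]_n.+1] (fun x => `|last_coord x|).
Proof.
exact: (measurableT_comp (@normr_measurable R setT) (measurable_coord ord_max)).
Qed.

End half_space.

(** Its unweighted norm of exponent 2* is the weighted norm of [u] for s = 0. *)
Definition weighted_abs {R : realType} {n : nat} (alpha : R)
    (u : 'rV[R]_n.+1 -> R) (x : 'rV[R]_n.+1) : R :=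
  `|last_coord x| `^ alpha * `|u x|.

(** The bound on the gradient of [weighted_abs] given by the product rule. *)
Definition weighted_slope {R : realType} {n : nat} (alpha : R)
    (u : 'rV[R]_n.+1 -> R) (x : 'rV[R]_n.+1) : R :=
  `|last_coord x| `^ alpha * enorm (gradient u x) +
  alpha * `|last_coord x| `^ (alpha - 1) * `|u x|.

Section weighted_functions.
Context {R : realType} {n : nat}.
Variables (u : 'rV[R]_n.+1 -> R) (alpha : R).

Lemma weighted_abs_ge0 x : 0 <= weighted_abs alpha u x.
Proof. by rewrite mulr_ge0 ?powR_ge0. Qed.

Lemma weighted_slope_ge0 x : 0 <= alpha -> 0 <= weighted_slope alpha u x.
Proof.
move=> a0; rewrite addr_ge0// mulr_ge0 ?powR_ge0 ?sqrtr_ge0//.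
by rewrite mulr_ge0 ?powR_ge0.
Qed.

Hypothesis su : smooth u.

Let mu_ : measurable_fun [set: 'rV[R]_n.+1] u.
Proof. exact: measurable_smooth. Qed.

Lemma measurable_weighted_abs :
  measurable_fun [set: 'rV[R]_n.+1] (weighted_abs alpha u).
Proof.
apply: measurable_funM; last exact: measurableT_comp.
by apply: measurable_fun_powR; exact: measurable_abs_last_coord.
Qed.

Lemma measurable_weighted_slope :
  measurable_fun [set: 'rV[R]_n.+1] (weighted_slope alpha u).
Proof.
apply: measurable_funD; apply: measurable_funM.
- by apply: measurable_fun_powR; exact: measurable_abs_last_coord.
- exact: measurable_enorm_gradient.
- apply: measurable_funM => //.
  by apply: measurable_fun_powR; exact: measurable_abs_last_coord.
- exact: measurableT_comp.
Qed.

Lemma measurable_weighted_gradient_sqr (r : R) :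
  measurable_fun [set: 'rV[R]_n.+1]
    (fun x => (`|last_coord x| `^ r * enorm (gradient u x) ^+ 2)%:E).
Proof.
apply/measurable_EFinP; apply: measurable_funM.
  by apply: measurable_fun_powR; exact: measurable_abs_last_coord.
by apply: measurable_funX; exact: measurable_enorm_gradient.
Qed.

Lemma measurable_weighted_sqr (r : R) : measurable_fun [set: 'rV[R]_n.+1]
  (fun x => (`|last_coord x| `^ r * u x ^+ 2)%:E).
Proof.
apply/measurable_EFinP; apply: measurable_funM; last exact: measurable_funX.
by apply: measurable_fun_powR; exact: measurable_abs_last_coord.
Qed.

Lemma measurable_weighted_powR (r p : R) : measurable_fun [set: 'rV[R]_n.+1]
  (fun x => (`|last_coord x| `^ r * `|u x| `^ p)%:E).
Proof.
apply/measurable_EFinP; apply: measurable_funM; apply: measurable_fun_powR.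
  exact: measurable_abs_last_coord.
exact: measurableT_comp.
Qed.

Lemma weighted_gradient_sqr_ge0 (r : R) x :
  (0 <= (`|last_coord x| `^ r * enorm (gradient u x) ^+ 2)%:E)%E.
Proof. by rewrite lee_fin mulr_ge0 ?powR_ge0 ?sqr_ge0. Qed.

Lemma weighted_sqr_ge0 (r : R) x :
  (0 <= (`|last_coord x| `^ r * u x ^+ 2)%:E)%E.
Proof. by rewrite lee_fin mulr_ge0 ?powR_ge0 ?sqr_ge0. Qed.

Lemma grad_energy_ge0 D : (0 <= grad_energy D alpha u)%E.
Proof. by apply: integral_ge0 => x _; exact: weighted_gradient_sqr_ge0. Qed.

End weighted_functions.

Section weighted_inequalities.
Context {R : realType} {n : nat}.
Local Notation lambda := (@lebesgue_measure R).
Local Notation mu := (lebesgue_rV n.+1).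
Variables (u : 'rV[R]_n.+1 -> R) (alpha : R).
Hypotheses (su : smooth u) (csu : compact_support u) (al : 1 / 2 < alpha).

Local Notation tau x := `|last_coord x|.
Local Notation v := (weighted_abs alpha u).
Local Notation gn x := (enorm (gradient u x)).
Local Notation h := (weighted_slope alpha u).

Let al0 : 0 < alpha. Proof. by apply: lt_trans al; rewrite divr_gt0. Qed.

Let v0 x : 0 <= v x. Proof. exact: weighted_abs_ge0. Qed.
Let h0 x : 0 <= h x. Proof. by apply: weighted_slope_ge0; exact: ltW. Qed.

Let mu_ : measurable_fun [set: 'rV[R]_n.+1] u.
Proof. exact: measurable_smooth. Qed.

Let mnu : measurable_fun [set: 'rV[R]_n.+1] (fun x => `|u x|).
Proof. exact: measurableT_comp. Qed.

Let mv : measurable_fun [set: 'rV[R]_n.+1] v.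
Proof. exact: measurable_weighted_abs. Qed.

Let mh : measurable_fun [set: 'rV[R]_n.+1] h.
Proof. exact: measurable_weighted_slope. Qed.

Let K : R := (2 / (2 * alpha - 1)) ^+ 2.

Let K0 : 0 <= K. Proof. exact: sqr_ge0. Qed.

Let line_deriv x i (t : R) :
  is_derive t 1 (fun t => u (rV_upd x i t)) (partial i u (rV_upd x i t)).
Proof. by apply: is_derive_line; exact: smooth_derivable. Qed.

Let line_cont x i : continuous (fun t : R => partial i u (rV_upd x i t)).
Proof.
move=> t; apply: (@continuous_comp _ _ _ (rV_upd x i) (partial i u)).
  exact: continuous_rV_upd.
exact: smooth_continuous_partial.
Qed.

Let line_support : exists M : R,
  forall x i t, M <= `|t| -> u (rV_upd x i t) = 0.
Proof.
have [M HM] := compact_support_box csu; exists M => x i t Mt.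
by apply: (HM _ i); rewrite mxE eqxx.
Qed.

Lemma hardy_half_space b :
  (\int[mu]_(x in half_space b) (tau x `^ (2 * alpha - 2) * u x ^+ 2)%:E <=
   K%:E * grad_energy (half_space b) alpha u)%E.
Proof.
rewrite /grad_energy -ge0_integralZl//; last 3 first.
- exact: measurable_half_space.
- by apply: measurable_funTS; exact: measurable_weighted_gradient_sqr.
- by move=> x _; exact: weighted_gradient_sqr_ge0.
apply: le_integral_half_space.
- exact: measurable_weighted_sqr.
- by apply: measurable_funeM; exact: measurable_weighted_gradient_sqr.
- by move=> x; exact: weighted_sqr_ge0.
- by move=> x; apply: mule_ge0 => //; exact: weighted_gradient_sqr_ge0.
move=> x; have [M HM] := line_support.
have lastE t : last_coord (rV_upd x ord_max t) = t.
  by rewrite /last_coord mxE eqxx.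
have := @hardy_half_line R _ _ M (line_deriv x ord_max) (@line_cont x ord_max)
   (HM x ord_max) b alpha al.
under eq_integral do rewrite -[X in `|X|]lastE.
move=> /le_trans; apply; rewrite -ge0_integralZl//; last 3 first.
- exact: measurable_half_line.
- apply/measurable_EFinP/measurable_funTS; apply: measurable_funM.
    by apply: measurable_fun_powR; exact: normr_measurable.
  apply: measurable_funX; apply: continuous_measurable_fun.
  exact: line_cont.
- by move=> t _; rewrite lee_fin mulr_ge0 ?powR_ge0 ?sqr_ge0.
apply: ge0_le_integral => //.
- exact: measurable_half_line.
- by move=> t _; rewrite mule_ge0// lee_fin mulr_ge0 ?powR_ge0 ?sqr_ge0.
- apply: measurable_funeM; apply/measurable_EFinP/measurable_funTS.
  apply: measurable_funM.
    by apply: measurable_fun_powR; exact: normr_measurable.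
  apply: measurable_funX; apply: continuous_measurable_fun.
  exact: line_cont.
- apply: measurable_funeM; apply: measurable_funTS.
  exact: (measurableT_comp (measurable_weighted_gradient_sqr su _)
    (measurable_rV_upd _ _)).
move=> t _; rewrite lee_fin ler_wpM2l// lastE ler_wpM2l ?powR_ge0//.
rewrite -[leLHS]real_normK ?num_real//.
by rewrite lerXn2r ?nnegrE ?sqrtr_ge0//; exact: partial_le_enorm.
Qed.

(** This is where Gagliardo's inequality meets the weight: normal to the
    boundary the weight is differentiated, while along the other directions it
    is constant. All line integrals stay on the same side of the boundary. *)
Lemma weighted_line_bounded b (q : R) : 1 < q ->
  line_bounded ((EFin \o (fun x => v x `^ q)) \_ (half_space b))
    ((EFin \o (fun x => q * v x `^ (q - 1) * h x)) \_ (half_space b)).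
Proof.
move=> q1 i x; have q0 : 0 < q by exact: lt_trans q1.
pose g x := q * v x `^ (q - 1) * h x.
rewrite -[fun x => q * _ * _]/g.
have g0 y : 0 <= g y.
  by rewrite mulr_ge0// mulr_ge0 ?powR_ge0// ltW.
have mg : measurable_fun [set: 'rV[R]_n.+1] g.
  apply: measurable_funM => //; apply: measurable_funM => //.
  exact: measurable_fun_powR.
have mgD : measurable_fun [set: 'rV[R]_n.+1] ((EFin \o g) \_ (half_space b)).
  apply/(measurable_restrictT _ (measurable_half_space b)).
  by apply/measurable_EFinP; exact: measurable_funTS.
have gD0 y : (0 <= ((EFin \o g) \_ (half_space b)) y)%E.
  by rewrite patchE; case: ifPn => // _; rewrite lee_fin.
rewrite [leLHS]patchE; case: ifPn => xD; last by apply: integral_ge0.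
have [M HM] := line_support.
have [iE|iN] := eqVneq i ord_max.
  rewrite iE integral_half_space_line.
  have lastE t : last_coord (rV_upd x ord_max t) = t.
    by rewrite /last_coord mxE eqxx.
  have bx : half_line b (last_coord x) by move: xD; rewrite inE.
  have := @weighted_power_le_integral R _ _ M (line_deriv x ord_max)
    (@line_cont x ord_max) (HM x ord_max) b q alpha _ q1 al0 bx.
  rewrite /= [rV_upd x ord_max (last_coord x)]rV_upd_id => /le_trans; apply.
  apply: ge0_le_integral => //.
  - exact: measurable_half_line.
  - move=> t _; rewrite lee_fin mulr_ge0//.
      by rewrite mulr_ge0 ?powR_ge0// ltW.
    by rewrite addr_ge0// mulr_ge0 ?powR_ge0// mulr_ge0 ?powR_ge0// ltW.
  - apply/measurable_EFinP/measurable_funTS.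
    have mu1 : measurable_fun [set: R] (fun t => `|u (rV_upd x ord_max t)|).
      exact: (measurableT_comp mnu (measurable_rV_upd _ _)).
    have mnp r : measurable_fun [set: R] (fun t => `|t| `^ r).
      by apply: measurable_fun_powR; exact: normr_measurable.
    apply: measurable_funM.
      apply: measurable_funM => //; apply: measurable_fun_powR.
      by apply: measurable_funM; [exact: mnp|exact: mu1].
    apply: measurable_funD; apply: measurable_funM.
    + exact: mnp.
    + apply: measurableT_comp => //.
      by apply: continuous_measurable_fun; exact: line_cont.
    + by apply: measurable_funM => //; exact: mnp.
    + exact: mu1.
  - apply/measurable_EFinP/measurable_funTS.
    exact: (measurableT_comp mg (measurable_rV_upd _ _)).
  move=> t _; rewrite lee_fin /g /weighted_abs /weighted_slope lastE.
  rewrite ler_wpM2l//.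
    by rewrite mulr_ge0 ?powR_ge0// ltW.
  by rewrite lerD2r ler_wpM2l ?powR_ge0//; exact: partial_le_enorm.
have lastE t : last_coord (rV_upd x i t) = last_coord x.
  by rewrite /last_coord mxE eq_sym (negbTE iN).
have := @norm_powR_le_integral_line R _ _ M (line_deriv x i) (@line_cont x i)
   (HM x i) q (x ord0 i) q1.
rewrite rV_upd_id => H.
have c0 : (0 <= ((tau x `^ alpha) `^ q)%:E)%E by rewrite lee_fin powR_ge0.
rewrite /= /weighted_abs powRM ?powR_ge0// EFinM.
apply: le_trans (lee_wpmul2l c0 H) _.
have mn : measurable_fun [set: R]
    (fun t => (q * `|u (rV_upd x i t)| `^ (q - 1) *
      `|partial i u (rV_upd x i t)|)%:E).
  apply/measurable_EFinP; apply: measurable_funM.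
    apply: measurable_funM => //; apply: measurable_fun_powR.
    exact: (measurableT_comp mnu (measurable_rV_upd _ _)).
  apply: measurableT_comp => //.
  by apply: continuous_measurable_fun; exact: line_cont.
rewrite -ge0_integralZl//; last first.
  by move=> t _; rewrite lee_fin !mulr_ge0 ?powR_ge0// ltW.
apply: ge0_le_integral => //.
- by move=> t _; rewrite mule_ge0// lee_fin !mulr_ge0 ?powR_ge0// ltW.
- exact: measurable_funeM.
- exact: (measurableT_comp mgD (measurable_rV_upd _ _)).
move=> t _; rewrite patchE half_space_upd// xD /= -EFinM lee_fin.
rewrite /g /weighted_abs /weighted_slope lastE powRM ?powR_ge0//.
have -> : (`|last_coord x| `^ alpha) `^ q =
    (`|last_coord x| `^ alpha) `^ (q - 1) * `|last_coord x| `^ alpha.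
  by rewrite -[X in _ * X]powRr1 ?powR_ge0// -powRD ?subrK// gt_eqF.
set A := _ `^ (q - 1); set B := _ `^ alpha; set C := _ `^ (q - 1).
rewrite [leLHS](_ : _ = q * (A * C) * (B * `|partial i u (rV_upd x i t)|));
  last by ring.
apply: ler_wpM2l; first by rewrite mulr_ge0 ?mulr_ge0 ?powR_ge0// ltW.
apply: (@le_trans _ _ (B * gn (rV_upd x i t))).
  by rewrite ler_wpM2l ?powR_ge0//; exact: partial_le_enorm.
by rewrite lerDl mulr_ge0// mulr_ge0 ?powR_ge0// ltW.
Qed.

Let c : R := 2 + 2 * alpha ^+ 2 * K.

(** The second term of the slope is the one that Hardy's inequality bounds. *)
Lemma weighted_slope_energy b :
  (\int[mu]_(x in half_space b) (h x ^+ 2)%:E <=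
   c%:E * grad_energy (half_space b) alpha u)%E.
Proof.
set D := half_space b; set E := grad_energy _ _ _.
have E0 : (0 <= E)%E by exact: grad_energy_ge0.
have hardyE := hardy_half_space b; rewrite -/D -/E in hardyE.
have mD : measurable D by exact: measurable_half_space.
have c2 : 0 <= 2 * alpha ^+ 2 by rewrite mulr_ge0 ?sqr_ge0.
have m1 : measurable_fun D (fun x => (tau x `^ (2 * alpha) * gn x ^+ 2)%:E).
  by apply: measurable_funTS; exact: measurable_weighted_gradient_sqr.
have m2 : measurable_fun D (fun x => (tau x `^ (2 * alpha - 2) * u x ^+ 2)%:E).
  by apply: measurable_funTS; exact: measurable_weighted_sqr.
have p1 := weighted_gradient_sqr_ge0 u (2 * alpha).
have p2 := weighted_sqr_ge0 u (2 * alpha - 2).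
apply: (@le_trans _ _ (\int[mu]_(x in D)
   (2%:E * (tau x `^ (2 * alpha) * gn x ^+ 2)%:E +
    (2 * alpha ^+ 2)%:E * (tau x `^ (2 * alpha - 2) * u x ^+ 2)%:E))%E).
  apply: ge0_le_integral => //.
  - by move=> x _; rewrite lee_fin sqr_ge0.
  - by apply/measurable_EFinP/measurable_funTS; exact: measurable_funX.
  - by apply: emeasurable_funD; exact: measurable_funeM.
  move=> x Dx; rewrite -!EFinM -EFinD lee_fin.
  have -> : tau x `^ (2 * alpha) = (tau x `^ alpha) ^+ 2.
    by rewrite mulrC powRrM powR_mulrn ?powR_ge0.
  have -> : tau x `^ (2 * alpha - 2) = (tau x `^ (alpha - 1)) ^+ 2.
    rewrite -powR_mulrn ?powR_ge0// -powRrM; congr (_ `^ _).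
    by ring.
  rewrite -[u x ^+ 2]real_normK ?num_real// /weighted_slope.
  set A := _ * gn x; set B := tau x `^ (alpha - 1); set C := `|u x|.
  rewrite [leRHS](_ : _ = (A + alpha * B * C) ^+ 2 + (A - alpha * B * C) ^+ 2).
    by rewrite lerDl sqr_ge0.
  by rewrite /A; ring.
rewrite ge0_integralD//; last 4 first.
- by move=> x _; rewrite mule_ge0.
- exact: measurable_funeM.
- by move=> x _; rewrite mule_ge0.
- exact: measurable_funeM.
have -> : c%:E = (2%:E + (2 * alpha ^+ 2 * K)%:E)%E by rewrite -EFinD.
rewrite ge0_integralZl// ge0_integralZl//.
rewrite ge0_muleDl ?lee_fin ?(mulr_ge0 c2 K0)//.
apply: leeD; first exact: lexx.
by rewrite [(2 * _ * K)%:E]EFinM -muleA; apply: lee_wpmul2l.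
Qed.

(** What makes the absorption below legitimate: [v] is bounded and vanishes
    outside a box. *)
Lemma weighted_power_fin_num b (P : R) : 0 < P ->
  (\int[mu]_(x in half_space b) (v x `^ P)%:E < +oo)%E.
Proof.
move=> P0; have [M HM] := compact_support_box csu.
have [B B0 HB] := compact_support_bounded (smooth_continuous su) csu.
have mvP : measurable_fun [set: 'rV[R]_n.+1] (fun x => (v x `^ P)%:E).
  by apply/measurable_EFinP; exact: measurable_fun_powR.
pose I : set (measurableTypeR R) := `[- M, M]%classic.
have mI : measurable I by exact: measurable_itv.
pose box : set 'rV[R]_n.+1 := [set x | forall i, I (x ord0 i)].
have mbox : measurable box.
  have -> : box = \bigcap_(i in [set: 'I_n.+1])
      ((fun x : 'rV[R]_n.+1 => x ord0 i : measurableTypeR R) @^-1` I).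
    by apply/seteqP; split => x /= hx i; [move=> _|]; exact: hx.
  apply: fin_bigcap_measurable => // i _.
  rewrite -[X in measurable X]setTI; apply: measurable_coord => //.
have boxfin : (mu box < +oo)%E.
  have -> : (mu box = \prod_(i < n.+1) lambda I)%E.
    exact: (lebesgue_rV_box (A := fun=> I)).
  rewrite -ge0_fin_numE; last first.
    by elim/big_ind : _ => // x y; exact: mule_ge0.
  elim/big_ind : _ => // [x y|_ _]; first exact: fin_numM.
  by rewrite /I lebesgue_measure_itv/=; case: ifP.
set W := (M `^ alpha * B) `^ P.
apply: (@le_lt_trans _ _ (\int[mu]_x (((cst W%:E) \_ box) x))%E); last first.
  rewrite -integral_mkcond integral_cst//.
  by apply: lte_mul_pinfty => //; rewrite lee_fin powR_ge0.
apply: (@le_trans _ _ (\int[mu]_x (v x `^ P)%:E)%E).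
  apply: ge0_subset_integral => //; first exact: measurable_half_space.
  by move=> x _; rewrite lee_fin powR_ge0.
apply: ge0_le_integral => //.
- by move=> x _; rewrite lee_fin powR_ge0.
- by apply/(measurable_restrictT _ mbox); exact: measurable_cst.
move=> x _; rewrite patchE; case: ifPn => xbox.
  have xM : tau x <= M.
    move: xbox; rewrite inE => /(_ ord_max).
    by rewrite /I/= in_itv/= -ler_norml.
  have M0 : 0 <= M by apply: le_trans xM; exact: normr_ge0.
  rewrite lee_fin /weighted_abs.
  apply: ge0_ler_powR; rewrite ?nnegrE ?mulr_ge0 ?powR_ge0//.
    exact: ltW.
  apply: ler_pM => //.
  by apply: ge0_ler_powR; rewrite ?nnegrE ?normr_ge0// ltW.
have ux0 : u x = 0.
  apply: contrapT => ux; move/negP: xbox; apply; rewrite inE => i; rewrite /I/=.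
  by rewrite in_itv/= -ler_norml leNgt; apply/negP => /ltW/HM.
by rewrite /weighted_abs ux0 normr0 mulr0 powR0// gt_eqF.
Qed.


End weighted_inequalities.

(** * The weighted Sobolev inequality *)

(** Dividing by a ^ r leaves the exponent 1 - r, which is positive. *)
Lemma powR_absorb (R : realType) (a c r : R) : 0 <= a -> 0 <= c -> 0 < r < 1 ->
  a <= (a * c) `^ r -> a <= c `^ (r / (1 - r)).
Proof.
move=> a0 c0 /andP[r0 r1] ac; have s0 : 0 < 1 - r by rewrite subr_gt0.
move: a0; rewrite le_eqVlt => /predU1P[<-|a0]; first exact: powR_ge0.
have le1 : a `^ (1 - r) <= c `^ r.
  rewrite powRB; last by rewrite (gt_eqF a0) implybT.
  rewrite (powRr1 (ltW a0)) ler_pdivrMr ?powR_gt0// mulrC.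
  by rewrite -powRM// ?(ltW a0)// mulrC.
have -> : a = (a `^ (1 - r)) `^ (1 - r)^-1.
  by rewrite -powRrM mulfV ?gt_eqF// powRr1 ?ltW.
rewrite powRrM; apply: ge0_ler_powR => //; rewrite ?nnegrE ?powR_ge0//.
by rewrite invr_ge0 ltW.
Qed.

Section weighted_sobolev.
Context {R : realType} {k : nat}.
Local Notation mu := (lebesgue_rV k.+3).
Variables (u : 'rV[R]_k.+3 -> R) (alpha : R) (b : bool).
Hypotheses (su : smooth u) (csu : compact_support u) (al : 1 / 2 < alpha).

Local Notation v := (weighted_abs alpha u).
Local Notation h := (weighted_slope alpha u).
Local Notation D := (half_space b : set 'rV[R]_k.+3).

Let al0 : 0 < alpha. Proof. by apply: lt_trans al; rewrite divr_gt0. Qed.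
Let v0 x : 0 <= v x. Proof. exact: weighted_abs_ge0. Qed.
Let h0 x : 0 <= h x. Proof. by apply: weighted_slope_ge0; exact: ltW. Qed.

Let mD : measurable D. Proof. exact: measurable_half_space. Qed.

Let mv : measurable_fun [set: 'rV[R]_k.+3] v.
Proof. exact: measurable_weighted_abs. Qed.

Let mh : measurable_fun [set: 'rV[R]_k.+3] h.
Proof. exact: measurable_weighted_slope. Qed.

Let c : R := 2 + 2 * alpha ^+ 2 * (2 / (2 * alpha - 1)) ^+ 2.

(* With N = k + 3, [q] is 2 (N - 1) / (N - 2) and [P] is 2* = 2 N / (N - 2), so
   that P = q N / (N - 1) and P = 2 (q - 1). *)
Let q : R := 2 * k.+2%:R / k.+1%:R.
Let P : R := 2 * k.+3%:R / k.+1%:R.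

Let k1 : 0 < k.+1%:R :> R. Proof. by rewrite ltr0n. Qed.
Let k2 : 0 < k.+2%:R :> R. Proof. by rewrite ltr0n. Qed.
Let k21 : k.+2%:R = k.+1%:R + 1 :> R.
Proof. by rewrite -(natrD _ k.+1 1) addn1. Qed.
Let k31 : k.+3%:R = k.+1%:R + 2 :> R.
Proof. by rewrite -(natrD _ k.+1 2) addn2. Qed.

Let q1 : 1 < q.
Proof. by rewrite /q ltr_pdivlMr// k21; have := k1; lra. Qed.

Let q0 : 0 < q. Proof. by apply: lt_trans q1. Qed.

Let P0 : 0 < P. Proof. by rewrite /P divr_gt0// mulr_gt0. Qed.

Let A := (\int[mu]_(x in D) (v x `^ P)%:E)%E.
Let J := (\int[mu]_(x in D) (h x ^+ 2)%:E)%E.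

Let mA : measurable_fun [set: 'rV[R]_k.+3] (fun x => (v x `^ P)%:E).
Proof. by apply/measurable_EFinP; exact: measurable_fun_powR. Qed.

Let mJ : measurable_fun [set: 'rV[R]_k.+3] (fun x => (h x ^+ 2)%:E).
Proof. by apply/measurable_EFinP; exact: measurable_funX. Qed.

Lemma gradient_product_bound :
  (\int[mu]_(x in D) (q * v x `^ (q - 1) * h x)%:E <=
   q%:E * (A `^ 2^-1 * J `^ 2^-1))%E.
Proof.
have half : 1 - 2^-1 = 2^-1 :> R by lra.
have Pq : P * 2^-1 = q - 1.
  by rewrite /P /q k21 k31; field; rewrite gt_eqF.
have m1 : measurable_fun [set: 'rV[R]_k.+3]
    (fun x => (v x `^ (q - 1) * h x)%:E).
  apply/measurable_EFinP; apply: measurable_funM => //.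
  exact: measurable_fun_powR.
under eq_integral do rewrite -mulrA EFinM.
rewrite ge0_integralZl//; last 3 first.
- exact: measurable_funTS.
- by move=> x _; rewrite lee_fin mulr_ge0 ?powR_ge0.
- by rewrite lee_fin ltW.
apply: lee_wpmul2l; first by rewrite lee_fin ltW.
rewrite -[X in (_ <= _ * _ `^ X)%E]half.
apply: le_trans (hoelder_poweR_on _ mD _ _ _ _ _).
- rewrite le_eqVlt; apply/orP; left; apply/eqP; apply: eq_integral => x _.
  rewrite half !poweR_EFin -powRrM Pq EFinM; congr (_ * _%:E)%E.
  by rewrite powR12_sqrt ?sqr_ge0// sqrtr_sqr ger0_norm.
- by lra.
- exact: measurable_funTS.
- exact: measurable_funTS.
- by move=> x _; rewrite lee_fin powR_ge0.
- by move=> x _; rewrite lee_fin sqr_ge0.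
Qed.

(** Gagliardo's inequality for the power [q] of the weighted function: by the
    choice of the exponents, the same integral [A] appears on both sides. *)
Lemma weighted_sobolev_implicit :
  (A <= (q%:E * (A `^ 2^-1 * J `^ 2^-1)) `^ (k.+3%:R / k.+2%:R))%E.
Proof.
have r0 : 0 <= k.+3%:R / k.+2%:R :> R by rewrite divr_ge0.
have Ag : (A <= (\int[mu]_(x in D) (q * v x `^ (q - 1) * h x)%:E)
    `^ (k.+3%:R / k.+2%:R))%E.
  pose w := (EFin \o (fun x => v x `^ q)) \_ D.
  pose g := (EFin \o (fun x => q * v x `^ (q - 1) * h x)) \_ D.
  have mw : measurable_fun setT w.
    apply/(measurable_restrictT _ mD)/measurable_EFinP/measurable_funTS.
    exact: measurable_fun_powR.
  have mg : measurable_fun setT g.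
    apply/(measurable_restrictT _ mD)/measurable_EFinP/measurable_funTS.
    apply: measurable_funM => //; apply: measurable_funM => //.
    exact: measurable_fun_powR.
  have w0 x : (0 <= w x)%E.
    by rewrite /w patchE; case: ifPn => // _; rewrite lee_fin powR_ge0.
  have g0 x : (0 <= g x)%E.
    rewrite /g patchE; case: ifPn => // _.
    by rewrite lee_fin mulr_ge0// mulr_ge0 ?powR_ge0// ltW.
  have wg : line_bounded w g by exact: weighted_line_bounded.
  have := gagliardo mw mg w0 g0 wg.
  rewrite -[X in (_ <= X `^ _)%E -> _]integral_mkcond; apply: le_trans.
  rewrite /A integral_mkcond le_eqVlt; apply/orP; left; apply/eqP.
  apply: eq_integral => x _; rewrite /w !patchE; case: ifPn => _.
    rewrite poweR_EFin -powRrM; congr ((_ `^ _)%:E).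
    by rewrite /P /q; field; rewrite !gt_eqF.
  by rewrite poweR0r// gt_eqF// divr_gt0.
apply: le_trans Ag _; apply: gt0_ler_poweR => //.
- rewrite in_itv/= leey andbT; apply: integral_ge0 => x _.
  by rewrite lee_fin mulr_ge0// mulr_ge0 ?powR_ge0// ltW.
- by rewrite in_itv/= leey andbT !mule_ge0 ?poweR_ge0// lee_fin ltW.
- exact: gradient_product_bound.
Qed.

(** On the right of the implicit inequality [A] has the exponent
    N / (2 (N - 1)), less than 1, and [A] is finite, so that it can be
    absorbed. *)
Lemma weighted_sobolev (e : R) : grad_energy D alpha u = e%:E ->
  (A <= ((q ^+ 2 * c * e) `^ (P / 2))%:E)%E.
Proof.
move=> Ee; have e0 : 0 <= e by rewrite -lee_fin -Ee grad_energy_ge0.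
have A0 : (0 <= A)%E by apply: integral_ge0 => x _; rewrite lee_fin powR_ge0.
have J0 : (0 <= J)%E by apply: integral_ge0 => x _; rewrite lee_fin sqr_ge0.
have /fineK AE : A \is a fin_num.
  by rewrite ge0_fin_numE// weighted_power_fin_num.
have Jle : (J <= (c * e)%:E)%E.
  by rewrite EFinM -Ee; exact: weighted_slope_energy.
have /fineK JE : J \is a fin_num.
  by rewrite ge0_fin_numE// (le_lt_trans Jle)// ltry.
have := weighted_sobolev_implicit; move: A0 J0 Jle.
rewrite -AE -JE; move: (fine A) (fine J) => a j.
rewrite (poweR_EFin a) (poweR_EFin j) -!EFinM poweR_EFin !lee_fin => a0 j0 jc.
have -> : q * (a `^ 2^-1 * j `^ 2^-1) = (a * (q ^+ 2 * j)) `^ 2^-1.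
  move: q q0 => y y0; have y2 : 0 <= y ^+ 2 by exact: sqr_ge0.
  rewrite (powRM _ a0 (mulr_ge0 y2 j0)) (powRM _ y2 j0).
  rewrite (powR12_sqrt y2) sqrtr_sqr.
  by rewrite gtr0_norm//; ring.
rewrite -powRrM => aj.
have c0 : 0 <= q ^+ 2 * j by rewrite mulr_ge0// sqr_ge0.
apply: le_trans (powR_absorb a0 c0 _ aj) _.
  apply/andP; split; first by rewrite mulr_gt0// ?invr_gt0// divr_gt0.
  rewrite mulrA ltr_pdivrMr// mul1r mulrC ltr_pdivrMr// k21 k31.
  by have := k1; lra.
rewrite (_ : _ / (1 - _) = P / 2); last first.
  rewrite /P k21 k31; field.
  have k0 : 0 <= k%:R :> R by [].
  by apply/andP; split; rewrite gt_eqF//; lra.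
apply: ge0_ler_powR; rewrite ?nnegrE.
- by rewrite divr_ge0// ltW.
- by [].
- by apply: le_trans c0 _; rewrite -mulrA ler_wpM2l ?sqr_ge0.
- by rewrite -mulrA ler_wpM2l ?sqr_ge0.
Qed.

End weighted_sobolev.

(** * Interpolation *)

(** Raising Hardy's integrand to the power [t] and Sobolev's to the power 1 - t
    adds up the exponents of [tau] and of the absolute value of [z] separately. *)
Lemma interpolation_pointwise (R : realType) (alpha P t tau z : R) :
  0 < tau -> 0 < 2 * t + P * (1 - t) ->
  tau `^ (alpha * (2 * t + P * (1 - t)) - 2 * t) *
    `|z| `^ (2 * t + P * (1 - t)) <=
  (tau `^ (2 * alpha - 2) * z ^+ 2) `^ t *
    ((tau `^ alpha * `|z|) `^ P) `^ (1 - t).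
Proof.
move=> tp p0; have [->|z0] := eqVneq z 0.
  rewrite normr0 (powR0 (lt0r_neq0 p0)) mulr0.
  by apply: mulr_ge0; exact: powR_ge0.
have zp : `|z| != 0 by rewrite normr_eq0.
have dp (x r r' : R) : x != 0 -> x `^ (r + r') = x `^ r * x `^ r'.
  by move=> x0; rewrite powRD// x0 implybT.
rewrite -[z ^+ 2]real_normK ?num_real// -powR_mulrn//.
rewrite !powRM ?powR_ge0// -!powRrM mulrACA -!dp ?(lt0r_neq0 tp)//.
by rewrite le_eqVlt; apply/orP; left; apply/eqP; congr (_ `^ _ * _ `^ _); ring.
Qed.

Section hardy_sobolev.
Context {R : realType} {k : nat}.
Local Notation mu := (lebesgue_rV k.+3).
Variables (s alpha : R).
Hypotheses (s0 : 0 <= s) (s2 : s <= 2) (al : 1 / 2 < alpha).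

Let p : R := crit_exp k.+3 s.
(* With N = k + 3, [P] and [q] are 2 N / (N - 2) and 2 (N - 1) / (N - 2). *)
Let P : R := 2 * k.+3%:R / k.+1%:R.
Let q : R := 2 * k.+2%:R / k.+1%:R.
Let t : R := s / 2.

Let k1 : 0 < k.+1%:R :> R. Proof. by rewrite ltr0n. Qed.
Let k31 : k.+3%:R = k.+1%:R + 2 :> R.
Proof. by rewrite -(natrD _ k.+1 2) addn2. Qed.

Let pE : p = 2 * t + P * (1 - t).
Proof.
rewrite /p /crit_exp /P /t k31; field.
by have kk : 0 <= k%:R :> R by []; rewrite gt_eqF//; lra.
Qed.

Let t01 : 0 <= t <= 1. Proof. by rewrite /t; have := s0; have := s2; lra. Qed.

Let P0 : 0 < P. Proof. by rewrite divr_gt0// mulr_gt0// ltr0n. Qed.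

Let p0 : 0 < p.
Proof.
rewrite /p /crit_exp k31 addrK divr_gt0// mulr_gt0//.
by have := k1; have := s2; lra.
Qed.

(* [K] is Hardy's constant, [q ^+ 2 * c] the one of the Sobolev inequality. *)
Let K : R := (2 / (2 * alpha - 1)) ^+ 2.
Let c : R := 2 + 2 * alpha ^+ 2 * K.
Let L : R := K `^ t * ((q ^+ 2 * c) `^ (P / 2)) `^ (1 - t).

Let K0 : 0 < K.
Proof. by rewrite exprn_gt0// divr_gt0//; have := al; lra. Qed.

Let q0 : 0 < q. Proof. by rewrite divr_gt0// mulr_gt0// ltr0n. Qed.

Let c0 : 0 < c.
Proof. by rewrite ltr_wpDr// mulr_ge0 ?(ltW K0)// mulr_ge0 ?sqr_ge0. Qed.

Let L0 : 0 < L.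
Proof. by rewrite mulr_gt0 ?powR_gt0// mulr_gt0// exprn_gt0. Qed.

Lemma half_space_interpolation b (u : 'rV[R]_k.+3 -> R) : smooth u ->
  (\int[mu]_(x in half_space b)
     (`|last_coord x| `^ (alpha * p - s) * `|u x| `^ p)%:E <=
   (\int[mu]_(x in half_space b)
     (`|last_coord x| `^ (2 * alpha - 2) * u x ^+ 2)%:E) `^ t *
   (\int[mu]_(x in half_space b)
     (weighted_abs alpha u x `^ P)%:E) `^ (1 - t))%E.
Proof.
move=> su.
have mf := measurable_weighted_sqr su (2 * alpha - 2).
have mg : measurable_fun [set: 'rV[R]_k.+3]
    (fun x => (weighted_abs alpha u x `^ P)%:E).
  apply/measurable_EFinP/measurable_fun_powR; exact: measurable_weighted_abs.
apply: le_trans (hoelder_poweR_on _ _ t01 _ _ _ _).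
- apply: ge0_le_integral.
  + exact: measurable_half_space.
  + by move=> x _; rewrite lee_fin mulr_ge0 ?powR_ge0.
  + by apply: measurable_funTS; exact: measurable_weighted_powR.
  + by apply: emeasurable_funM; apply: measurable_fun_poweR;
      exact: measurable_funTS.
  move=> x Dx; rewrite !poweR_EFin -EFinM lee_fin.
  have -> : s = 2 * t by rewrite /t mulrC divfK.
  rewrite pE; apply: interpolation_pointwise; last by rewrite -pE.
  exact: half_space_last_coord Dx.
- exact: measurable_half_space.
- exact: measurable_funTS.
- exact: measurable_funTS.
- by move=> x _; exact: weighted_sqr_ge0.
- by move=> x _; rewrite lee_fin powR_ge0.
Qed.

(** The powers of the energy furnished by the two endpoint inequalities add up
    to p / 2, so that the root of order p / 2 is linear in the energy. *)
Lemma half_space_inequality : exists2 C : R, 0 < C &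
  forall b (u : 'rV[R]_k.+3 -> R), Cc_infty u ->
  (C%:E * weighted_Lp_sq (half_space b) s alpha u <=
     grad_energy (half_space b) alpha u)%E.
Proof.
exists (L `^ (2 / p))^-1; first by rewrite invr_gt0 powR_gt0.
move=> b u [su cu].
have E0 := grad_energy_ge0 u alpha (half_space b).
have [->|Ey] := eqVneq (grad_energy (half_space b) alpha u) +oo%E.
  exact: leey.
have /fineK : grad_energy (half_space b) alpha u \is a fin_num.
  by rewrite ge0_fin_numE// ltey.
set e := fine _ => Ee; have e0 : 0 <= e by rewrite -lee_fin Ee.
rewrite -Ee lee_pdivrMl ?powR_gt0//.
have I0 : (0 <= \int[mu]_(x in half_space b)
     (`|last_coord x| `^ (alpha * p - s) * `|u x| `^ p)%:E)%E.
  by apply: integral_ge0 => x _; rewrite lee_fin mulr_ge0 ?powR_ge0.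
suff IL : (\int[mu]_(x in half_space b)
     (`|last_coord x| `^ (alpha * p - s) * `|u x| `^ p)%:E <=
    (L * e `^ (p / 2))%:E)%E.
  have p20 : 0 <= 2 / p by rewrite divr_ge0// ltW.
  rewrite /weighted_Lp_sq -/p.
  apply: le_trans (gt0_ler_poweR p20 _ _ IL) _.
  - by rewrite in_itv/= I0 leey.
  - by rewrite in_itv/= leey andbT lee_fin mulr_ge0 ?powR_ge0// ltW.
  rewrite poweR_EFin powRM ?powR_ge0 ?(ltW L0)// -powRrM.
  by rewrite (_ : p / 2 * (2 / p) = 1) ?powRr1//; field; rewrite gt_eqF.
apply: le_trans (half_space_interpolation b su) _.
have hardy := hardy_half_space su cu al b.
have sobolev := weighted_sobolev su cu al (esym Ee).
rewrite -Ee -EFinM in hardy.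
move: sobolev; rewrite -/K -/c -/q -/P => sobolev.
have t0 : 0 <= t by case/andP: t01.
have t1 : 0 <= 1 - t by rewrite subr_ge0; case/andP: t01.
have qc0 : 0 <= q ^+ 2 * c by rewrite mulr_ge0 ?sqr_ge0// ltW.
have -> : (L * e `^ (p / 2))%:E =
    ((K * e)%:E `^ t * ((q ^+ 2 * c * e) `^ (P / 2))%:E `^ (1 - t))%E.
  rewrite !poweR_EFin -EFinM; congr EFin.
  rewrite (powRM _ (ltW K0) e0) (powRM _ qc0 e0).
  rewrite [X in _ = _ * X]powRM ?powR_ge0// mulrACA -/L; congr (_ * _).
  have [->|eN0] := eqVneq e 0.
    have p2 : p / 2 != 0 by rewrite gt_eqF// divr_gt0.
    have P2 : P / 2 != 0 by rewrite gt_eqF// divr_gt0.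
    rewrite (powR0 p2) (powR0 P2).
    have [->|tN0] := eqVneq t 0; last by rewrite powR0// mul0r.
    by rewrite subr0 powRr1// mulr0.
  rewrite -powRrM -powRD; last by rewrite eN0 implybT.
  by rewrite pE; congr (_ `^ _); field.
apply: lee_pmul; rewrite ?poweR_ge0//.
- apply: gt0_ler_poweR => //; rewrite in_itv/= leey andbT.
    by apply: integral_ge0 => x _; exact: weighted_sqr_ge0.
  by rewrite lee_fin mulr_ge0// ltW.
- apply: gt0_ler_poweR => //; rewrite in_itv/= leey andbT.
    by apply: integral_ge0 => x _; rewrite lee_fin powR_ge0.
  by rewrite lee_fin powR_ge0.
Qed.

End hardy_sobolev.

(** * From the half-spaces to the whole space *)

Section whole_space.
Context {R : realType} {n : nat}.
Local Notation mu := (lebesgue_rV n.+1).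
Local Open Scope ereal_scope.

Lemma half_spaces_disjoint :
  [disjoint half_space false & half_space true : set 'rV[R]_n.+1].
Proof.
apply/disj_setPS => x [].
rewrite /half_space /half_line/= mul1r expr1 mulN1r oppr_gt0 => xp xn.
by have := lt_trans xp xn; rewrite ltxx.
Qed.

Lemma half_spacesC : ~` (half_space false `|` half_space true) =
  [set x : 'rV[R]_n.+1 | last_coord x = 0%R].
Proof.
apply/seteqP; split => x; rewrite /half_space /half_line/=;
  rewrite expr0 mul1r expr1 mulN1r oppr_gt0.
  move=> /not_orP[/negP + /negP]; rewrite -!leNgt => ? ?.
  by apply/eqP; rewrite eq_le; apply/andP.
by move=> ->; rewrite ltxx => -[].
Qed.

Lemma hyperplane_null : mu [set x : 'rV[R]_n.+1 | last_coord x = 0%R] = 0.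
Proof.
pose A (i : 'I_n.+1) : set (measurableTypeR R) :=
  if i == ord_max then [set 0%R] else setT.
have -> : [set x : 'rV[R]_n.+1 | last_coord x = 0%R] =
    [set x | forall i, A i (x ord0 i)].
  apply/seteqP; split => x /= h.
    by move=> i; rewrite /A; case: eqP => // ->.
  by have := h ord_max; rewrite /A eqxx.
rewrite lebesgue_rV_box => [|i]; last first.
  by rewrite /A; case: ifP => // _; exact: measurable_set1.
by rewrite (bigD1 ord_max)//= /A eqxx lebesgue_measure_set1 mul0e.
Qed.

Lemma integral_half_spaces (f : 'rV[R]_n.+1 -> \bar R) :
  measurable_fun setT f -> (forall x, 0 <= f x) ->
  \int[mu]_x f x = \int[mu]_(x in half_space false) f x +
                   \int[mu]_(x in half_space true) f x.
Proof.
move=> mf f0.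
have mH b : measurable (half_space b : set 'rV[R]_n.+1).
  exact: measurable_half_space.
have mU : measurable (half_space false `|` half_space true : set 'rV[R]_n.+1).
  exact: measurableU.
rewrite -(setUv (half_space false `|` half_space true)).
rewrite ge0_integral_setU//; last 3 first.
- exact: measurableC.
- by rewrite setUv.
- by apply/disj_setPS => x [].
have -> : \int[mu]_(x in ~` (half_space false `|` half_space true)) f x = 0.
  have /= := integral_abs_eq0 (measurableC mU) (measurable_funTS mf).
  rewrite half_spacesC => /(_ _ hyperplane_null) <-.
  by apply: eq_integral => x _; rewrite gee0_abs.
rewrite adde0 ge0_integral_setU//; first exact: measurable_funTS.
exact: half_spaces_disjoint.
Qed.

(** Each summand is at most the larger one, which accounts for the factor
    2 ^ r. *)
Lemma poweR_add_le (x y : \bar R) (r : R) : (0 <= r)%R -> 0 <= x -> 0 <= y ->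
  (x + y) `^ r <= (2 `^ r)%:E * (x `^ r + y `^ r).
Proof.
move=> r0; wlog xy : x y / x <= y => [hw x0 y0|x0 y0].
  have [xy|/ltW yx] := leP x y; first exact: hw.
  by rewrite addeC [X in _ <= _ * X]addeC; exact: hw.
apply: (@le_trans _ _ ((2%:E * y) `^ r)).
  apply: gt0_ler_poweR => //.
  - by rewrite in_itv/= leey adde_ge0.
  - by rewrite in_itv/= leey mule_ge0.
  by rewrite mule_natl mule2n leeD2r.
rewrite poweRM// poweR_EFin lee_wpmul2l ?lee_fin ?powR_ge0//.
by rewrite leeDr// poweR_ge0.
Qed.

End whole_space.

Unset Implicit Arguments.
Set Strict Implicit.

(* N = n.+1, so that the last coordinate x_N is x ord0 ord_max *)
Theorem theorem2p1 (R : realType) (n : nat) (hN : (3 <= n.+1)%N)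
    (s alpha : R) (hs0 : 0 <= s) (hs2 : s <= 2) (halpha : 1 / 2 < alpha) :
  exists C C' : R, [/\ 0 < C, 0 < C' &
    forall u : 'rV[R]_n.+1 -> R, Cc_infty u ->
      [/\ (C'%:E * weighted_Lp_sq upper_half s alpha u <=
             grad_energy upper_half alpha u)%E,
          (C'%:E * weighted_Lp_sq lower_half s alpha u <=
             grad_energy lower_half alpha u)%E &
          (C%:E * weighted_Lp_sq [set: 'rV[R]_n.+1] s alpha u <=
             grad_energy [set: 'rV[R]_n.+1] alpha u)%E]].
Proof.
case: n hN => [//|[//|k]] _.
have [C' C'0 half] := @half_space_inequality R k s alpha hs0 hs2 halpha.
have upperE : upper_half = half_space false :> set 'rV[R]_k.+3.
  apply/seteqP; split => x;
    by rewrite /upper_half /half_space /half_line /= expr0 mul1r.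
have lowerE : lower_half = half_space true :> set 'rV[R]_k.+3.
  apply/seteqP; split => x;
    by rewrite /lower_half /half_space /half_line /= expr1 mulN1r oppr_gt0.
pose p := crit_exp k.+3 s.
have r0 : 0 <= 2 / p.
  rewrite divr_ge0// /p /crit_exp !mulr_ge0 ?invr_ge0 ?subr_ge0 ?ler_nat//.
  by rewrite (le_trans hs2)// ler_nat.
have c0 : 0 < 2 `^ (2 / p) by exact: powR_gt0.
exists (C' / 2 `^ (2 / p)), C'; split => //; first exact: divr_gt0.
move=> u Cu; rewrite upperE lowerE; split; [exact: half|exact: half|].
have [su _] := Cu.
have hl := half false u Cu; have hr := half true u Cu.
rewrite /weighted_Lp_sq -/p in hl hr *.
rewrite /grad_energy !integral_half_spaces; last 4 first.
- exact: measurable_weighted_gradient_sqr.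
- by move=> x; exact: weighted_gradient_sqr_ge0.
- exact: measurable_weighted_powR.
- by move=> x; rewrite lee_fin mulr_ge0 ?powR_ge0.
apply: le_trans (leeD hl hr).
set X := (\int[_]_(x in half_space false) (_ * `|u x| `^ p)%:E)%E.
set Y := (\int[_]_(x in half_space true) (_ * `|u x| `^ p)%:E)%E.
have X0 : (0 <= X)%E.
  by apply: integral_ge0 => x _; rewrite lee_fin mulr_ge0 ?powR_ge0.
have Y0 : (0 <= Y)%E.
  by apply: integral_ge0 => x _; rewrite lee_fin mulr_ge0 ?powR_ge0.
rewrite -ge0_muleDr ?poweR_ge0// [C' / _]mulrC EFinM -muleA lee_pdivrMl//.
rewrite muleCA lee_pmul2l//; exact: poweR_add_le.
Qed.
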